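(* There is an absolute constant $C$ such that the following holds. Let $\tau=k^{-7}$ and $t=\frac{1}{\tau^2}\big(3\ln(1/\tau)+\ln R\big)+\lceil 4k^2\ln k\rceil\cdot\big\lceil\frac{4}{\tau^2}\ln(1/\tau)\big\rceil$. Let $h(\vec y)=\mathrm{sgn}(\langle\vec w,\vec y\rangle-\theta)$ be a halfspace on $\{0,1\}^{kR}$ such that $B_t(\vec w_i)\cap B_t(\vec w_j)=\emptyset$ for all $i\ne j\in[k]$. Then $h$ passes the dictatorship test with probability at most $\frac12+\frac Ck$.
   Context: $\mathrm{sgn}(t)=1$ if $t\ge0$, else $0$. Fix integers $k\ge2$, $R\ge1$, and distributions $\mathcal D_0,\mathcal D_1$ on $\{0,1\}^k$ with $\Pr_{\mathcal D_0}[\text{all }x_l=0]\ge 1-2/\sqrt k$, $\Pr_{\mathcal D_1}[\text{all }x_l=0]\le 1/\sqrt k$, and matching moments up to degree $4$ (i.e. $\mathbb E[\prod_{i\in S}x_i]$ agrees under both for every multiset $S\subseteq[k]$, $|S|\le4$). Points of $\{0,1\}^{kR}$ are $k\times R$ matrices $\vec y=(y_i^{(j)})$; for $\vec w\in\mathbb R^{k\times R}$, $\vec w_i\in\mathbb R^R$ is its $i$-th row. Dictatorship test on $h$: pick a uniform bit $b$; draw the $R$ columns of $\vec x$ independently from $\mathcal D_b$; independently for each $(i,j)$ set $y_i^{(j)}=x_i^{(j)}$ w.p. $1-1/k^2$ and a fresh uniform bit w.p. $1/k^2$; accept iff $h(\vec y)=b$. For $\vec u\in\mathbb R^n$, order the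 indices as $i_1,\dots,i_n$ by decreasing $|u^{(i)}|$ with ties broken by increasing index, and let $B_t(\vec u)=\{i_1,\dots,i_{\min(t,n)}\}$. *)

(* Defs.v *)
From Stdlib Require Import Reals List Zfloor.
Import ListNotations.
Open Scope R_scope.

Definition sumR {A : Type} (l : list A) (f : A -> R) : R :=
  fold_right (fun a acc => f a + acc) 0 l.

Fixpoint bvecs (n : nat) : list (list bool) :=
  match n with
  | O => [[]]
  | S n' => flat_map (fun v => [false :: v; true :: v]) (bvecs n')
  end.

Fixpoint lists_of {A : Type} (l : list A) (n : nat) : list (list A) :=
  match n with
  | O => [[]]
  | S n' => flat_map (fun v => map (fun a => a :: v) l) (lists_of l n')
  end.

Definition b2R (b : bool) : R := if b then 1 else 0.

Definition is_distr (k : nat) (D : list bool -> R) : Prop :=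
  (forall v, In v (bvecs k) -> 0 <= D v) /\ sumR (bvecs k) D = 1.

(* E_D [ prod_{i in S} x_i ] for a multiset S given as a list of indices *)
Definition moment (k : nat) (D : list bool -> R) (S : list nat) : R :=
  sumR (bvecs k) (fun x => D x * fold_right (fun i acc => b2R (nth i x false) * acc) 1 S).

Definition moments_match4 (k : nat) (D0 D1 : list bool -> R) : Prop :=
  forall S : list nat, (length S <= 4)%nat -> (forall i, In i S -> (i < k)%nat) ->
    moment k D0 S = moment k D1 S.

Definition pr_allzero (k : nat) (D : list bool -> R) : R := D (repeat false k).

(* A point of {0,1}^{kR}: a list of R columns, each a bit vector of length k.
   Entry y_i^(j) : *)
Definition entry (y : list (list bool)) (i j : nat) : bool := nth i (nth j y []) false.

Definition halfspace (k Rn : nat) (w : nat -> nat -> R) (theta : R)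
  (y : list (list bool)) : bool :=
  if Rle_dec 0 (sumR (seq 0 k) (fun i => sumR (seq 0 Rn)
        (fun j => w i j * b2R (entry y i j))) - theta) then true else false.

(* P(y = c | x = a) for the noise: keep w.p. 1-1/k^2, else a fresh uniform bit *)
Definition noise (k : nat) (a c : bool) : R :=
  (1 - 1 / (INR k)^2) * (if Bool.eqb a c then 1 else 0) + (1 / (INR k)^2) * (1/2).

Definition test_prob (k Rn : nat) (D : list bool -> R) (y : list (list bool)) : R :=
  sumR (lists_of (bvecs k) Rn) (fun x =>
    fold_right Rmult 1 (map D x) *
    fold_right Rmult 1
      (map (fun j => fold_right Rmult 1
         (map (fun i => noise k (entry x i j) (entry y i j)) (seq 0 k))) (seq 0 Rn))).

Definition accept_prob (k Rn : nat) (D0 D1 : list bool -> R)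
  (h : list (list bool) -> bool) : R :=
  (1/2) * sumR (lists_of (bvecs k) Rn)
            (fun y => test_prob k Rn D0 y * (if h y then 0 else 1))
  + (1/2) * sumR (lists_of (bvecs k) Rn)
            (fun y => test_prob k Rn D1 y * (if h y then 1 else 0)).

(* rank of index i in u = (u 0,...,u (n-1)) ordered by decreasing |u|,
   ties broken by increasing index: number of indices strictly before i *)
Definition rank_in (n : nat) (u : nat -> R) (i : nat) : nat :=
  length (filter (fun j =>
    if Rlt_dec (Rabs (u i)) (Rabs (u j)) then true
    else if Req_EM_T (Rabs (u j)) (Rabs (u i)) then Nat.ltb j i else false)
    (seq 0 n)).

(* i is in B_t(u) = {i_1, ..., i_min(t,n)} : i = i_m with m = rank+1 <= t *)
Definition inB (t : R) (n : nat) (u : nat -> R) (i : nat) : Prop :=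
  (i < n)%nat /\ INR (rank_in n u i) + 1 <= t.

Definition tau (k : nat) : R := / (INR k) ^ 7.

Definition t_param (k Rn : nat) : R :=
  (1 / (tau k)^2) * (3 * ln (1 / tau k) + ln (INR Rn))
  + IZR (Zceil (4 * (INR k)^2 * ln (INR k)))
    * IZR (Zceil (4 / (tau k)^2 * ln (1 / tau k))).

(* Main.v *)
(* The acceptance probability is 1/2 + (E_1 h - E_0 h)/2, where E_b is the expectation over
   the noisy matrix built from D_b, so the two expectations must be O(1/k)-close.

   Each row of w has a head of at most t largest weights after which it is either
   tau-regular or has decayed geometrically.  In the second case the tail is deleted: the
   head contains 4 k^2 ln k weights so well separated that the noise alone puts the score
   within the total deleted mass of theta with probability at most k^-2 (only the row with
   the largest deleted mass has to be considered).

   Once all tails are regular, let T^2 be the total squared tail weight.  The threshold is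
   smoothed at scale T/k^2.  Given x, the bits of y are independent, and the characteristic
   function of their tail part decays like a Gaussian of variance of order T^2/k^2, so
   smoothing costs O(1/k).  The smooth test function is exchanged column by column: since
   the heads are disjoint, a column contains at most one head bit, of which any function is
   affine, and the third-order Taylor polynomial in the tail involves moments of degree at
   most 4, which match. The fourth-order remainders add up to O(k^11 tau^2) = O(1/k^3). *)
Require Import Defs.
From Stdlib Require Import Reals List.
From Stdlib Require Import Lra Lia Permutation ZArith Zfloor Classical.
From Coquelicot Require Import Coquelicot.
Import ListNotations.
Open Scope R_scope.

(** * Finite sums and products *)

Lemma sumR_cons {A} (a : A) l f : sumR (a :: l) f = f a + sumR l f.
Proof. reflexivity. Qed.

Lemma sumR_ext {A} (l : list A) f g :
  (forall a, In a l -> f a = g a) -> sumR l f = sumR l g.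
Proof.
  induction l as [|a l IH]; intros H; [reflexivity|].
  rewrite !sumR_cons, H, IH; auto with datatypes.
Qed.

Lemma sumR_zero {A} (l : list A) f : (forall a, In a l -> f a = 0) -> sumR l f = 0.
Proof.
  induction l as [|a l IH]; intros H; [reflexivity|].
  rewrite sumR_cons, H, IH; auto with datatypes. lra.
Qed.

Lemma sumR_plus {A} (l : list A) f g :
  sumR l (fun a => f a + g a) = sumR l f + sumR l g.
Proof. induction l; simpl; [lra|rewrite IHl; lra]. Qed.

Lemma sumR_minus {A} (l : list A) f g :
  sumR l (fun a => f a - g a) = sumR l f - sumR l g.
Proof. induction l; simpl; [lra|rewrite IHl; lra]. Qed.

Lemma sumR_scal {A} (l : list A) c f : sumR l (fun a => c * f a) = c * sumR l f.
Proof. induction l; simpl; [lra|rewrite IHl; lra]. Qed.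

Lemma sumR_scal_r {A} (l : list A) c f : sumR l (fun a => f a * c) = sumR l f * c.
Proof. induction l; simpl; [lra|rewrite IHl; lra]. Qed.

Lemma sumR_le {A} (l : list A) f g :
  (forall a, In a l -> f a <= g a) -> sumR l f <= sumR l g.
Proof.
  induction l as [|a l IH]; intros H; simpl; [lra|].
  apply Rplus_le_compat; [|apply IH; intros]; apply H; simpl; auto.
Qed.

Lemma sumR_nonneg {A} (l : list A) f : (forall a, In a l -> 0 <= f a) -> 0 <= sumR l f.
Proof.
  intros H. rewrite <- (sumR_zero l (fun _ => 0)) by auto. apply sumR_le; auto.
Qed.

Lemma sumR_abs {A} (l : list A) f : Rabs (sumR l f) <= sumR l (fun a => Rabs (f a)).
Proof.
  induction l; simpl; [rewrite Rabs_R0; lra|].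
  eapply Rle_trans; [apply Rabs_triang|lra].
Qed.

Lemma sumR_app {A} (l l' : list A) f : sumR (l ++ l') f = sumR l f + sumR l' f.
Proof. induction l; simpl; [lra|rewrite IHl; lra]. Qed.

Lemma sumR_map {A B} (h : A -> B) l f : sumR (map h l) f = sumR l (fun a => f (h a)).
Proof. induction l; simpl; congruence. Qed.

Lemma sumR_flat_map {A B} (h : A -> list B) l f :
  sumR (flat_map h l) f = sumR l (fun a => sumR (h a) f).
Proof. induction l; simpl; [reflexivity|rewrite sumR_app; congruence]. Qed.

Lemma sumR_swap {A B} (l : list A) (l' : list B) f :
  sumR l (fun a => sumR l' (f a)) = sumR l' (fun b => sumR l (fun a => f a b)).
Proof.
  induction l; simpl.
  - symmetry; apply sumR_zero; reflexivity.
  - rewrite IHl, <- sumR_plus. reflexivity.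
Qed.

Lemma sumR_seq_S n f : sumR (seq 0 (S n)) f = f O + sumR (seq 0 n) (fun i => f (S i)).
Proof. simpl. rewrite <- seq_shift. fold (sumR (map S (seq 0 n)) f). now rewrite sumR_map. Qed.

Lemma sumR_const {A} (l : list A) c : sumR l (fun _ => c) = INR (length l) * c.
Proof.
  induction l; [simpl; lra|]. rewrite sumR_cons, IHl.
  change (length (a :: l)) with (S (length l)). rewrite S_INR. lra.
Qed.

Lemma sumR_term_le {A} (l : list A) f a :
  (forall b, In b l -> 0 <= f b) -> In a l -> f a <= sumR l f.
Proof.
  induction l as [|b l IH]; intros H Ha; [easy|]. rewrite sumR_cons.
  assert (0 <= sumR l f) by (apply sumR_nonneg; auto with datatypes).
  assert (0 <= f b) by auto with datatypes.
  destruct Ha as [->|Ha]; [lra|].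
  assert (f a <= sumR l f) by (apply IH; auto with datatypes). lra.
Qed.

Lemma sumR_filter {A} (q : A -> bool) l f :
  sumR (filter q l) f = sumR l (fun a => if q a then f a else 0).
Proof. induction l; simpl; [reflexivity|]. destruct (q a); simpl; rewrite IHl; lra. Qed.

(** Cauchy-Schwarz against the constant 1. The inductive step is the square [(n * f a - s)^2 >= 0]
    divided by [n], so the empty list is treated apart. *)
Lemma sumR_sqr_le {A} (l : list A) f :
  (sumR l f)^2 <= INR (length l) * sumR l (fun a => (f a)^2).
Proof.
  induction l as [|a l IH]; [simpl; lra|].
  rewrite !sumR_cons. change (length (a :: l)) with (S (length l)). rewrite S_INR.
  set (s := sumR l f) in *. set (q := sumR l (fun a => (f a)^2)) in *.
  set (n := INR (length l)) in *.
  assert (Hn : 0 <= n) by apply pos_INR.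
  assert (Hq : 0 <= q) by (apply sumR_nonneg; intros; nra).
  destruct (Req_dec n 0) as [E|E].
  - rewrite E in *. assert (s = 0) by (apply Rsqr_0_uniq; unfold Rsqr; nra).
    rewrite H. nra.
  - assert (0 < n) by lra.
    assert (0 <= (n * f a - s)^2) by apply pow2_ge_0.
    assert (2 * f a * s * n <= n * n * (f a)^2 + n * q) by lra.
    assert (2 * f a * s <= n * (f a)^2 + q).
    { apply Rmult_le_reg_r with n; lra. }
    nra.
Qed.

(** Convertible with the products in [test_prob], so [fold] and [reflexivity] can pass between the
    two. *)
Definition prodR {A : Type} (l : list A) (f : A -> R) : R := fold_right Rmult 1 (map f l).

Lemma prodR_seq_S n f : prodR (seq 0 (S n)) f = f O * prodR (seq 0 n) (fun i => f (S i)).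
Proof. unfold prodR. simpl. now rewrite <- seq_shift, map_map. Qed.

Lemma prodR_ext {A} (l : list A) f g :
  (forall a, In a l -> f a = g a) -> prodR l f = prodR l g.
Proof. intros H. unfold prodR. now rewrite (map_ext_in _ _ _ H). Qed.

Lemma prodR_mult {A} (l : list A) f g :
  prodR l (fun a => f a * g a) = prodR l f * prodR l g.
Proof. unfold prodR. induction l; simpl; [lra|rewrite IHl; lra]. Qed.

Lemma prodR_nonneg {A} (l : list A) f :
  (forall a, In a l -> 0 <= f a) -> 0 <= prodR l f.
Proof.
  unfold prodR. induction l; intros H; simpl; [lra|].
  apply Rmult_le_pos; auto with datatypes.
Qed.

Lemma prodR_filter {A} (q : A -> bool) l f :
  prodR (filter q l) f = prodR l (fun a => if q a then f a else 1).
Proof.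
  unfold prodR. induction l; simpl; [reflexivity|]. destruct (q a); simpl; rewrite IHl; lra.
Qed.

(** Choice over finitely many indices, by induction; [b0] only fills the values from [n] on. *)
Lemma finite_choice {B} (P : nat -> B -> Prop) (b0 : B) n :
  (forall i, (i < n)%nat -> exists b, P i b) ->
  exists f, forall i, (i < n)%nat -> P i (f i).
Proof.
  induction n as [|n IH]; intros H.
  - exists (fun _ => b0). intros; lia.
  - destruct IH as [f Hf]; [intros; apply H; lia|].
    destruct (H n) as [b Hb]; [lia|].
    exists (fun i => if Nat.eqb i n then b else f i). intros i Hi.
    destruct (Nat.eqb_spec i n); [congruence|apply Hf; lia].
Qed.

Lemma exists_argmax (f : nat -> R) n : (1 <= n)%nat ->
  exists i, (i < n)%nat /\ forall j, (j < n)%nat -> f j <= f i.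
Proof.
  induction n as [|[|n] IH]; intros H; [lia| |].
  - exists O. split; [lia|]. intros j Hj. replace j with O by lia. lra.
  - destruct IH as [i [Hi Hm]]; [lia|].
    destruct (Rle_dec (f i) (f (S n))) as [L|L].
    + exists (S n). split; [lia|]. intros j Hj.
      destruct (Nat.eq_dec j (S n)); [subst; lra|].
      assert (f j <= f i) by (apply Hm; lia). lra.
    + exists i. split; [lia|]. intros j Hj.
      destruct (Nat.eq_dec j (S n)); [subst; lra|apply Hm; lia].
Qed.

(** * Sums of independent bits *)

(* [bitE L G] is E[G(sum of a*y)] for independent bits y, one for each (a, p) in L,
   with Pr[y = 1] = p. *)
Fixpoint bitE (L : list (R * R)) (G : R -> R) : R :=
  match L with
  | [] => G 0
  | (a, p) :: L' => (1 - p) * bitE L' G + p * bitE L' (fun s => G (a + s))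
  end.

(** The noise gives [p0 = 1/(2k^2)]: whatever the original bit, either value of the noisy bit keeps
    at least this probability. *)
Definition probs_in (p0 : R) (L : list (R * R)) : Prop :=
  forall a p, In (a, p) L -> p0 <= p <= 1 - p0.

Lemma probs_in_cons p0 a p L :
  probs_in p0 ((a, p) :: L) -> p0 <= p <= 1 - p0 /\ probs_in p0 L.
Proof. intros H. split; [apply (H a); now left|]. intros b q Hb. apply (H b). now right. Qed.

Lemma bitE_ext L : forall G G', (forall s, G s = G' s) -> bitE L G = bitE L G'.
Proof.
  induction L as [|[a p] L IH]; intros G G' H; simpl; [apply H|].
  rewrite (IH G G' H), (IH (fun s => G (a + s)) (fun s => G' (a + s))); auto.
Qed.

Lemma bitE_lin L : forall c d G G',
  bitE L (fun s => c * G s + d * G' s) = c * bitE L G + d * bitE L G'.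
Proof.
  induction L as [|[a p] L IH]; intros c d G G'; simpl; [lra|].
  rewrite IH, (IH c d (fun s => G (a + s)) (fun s => G' (a + s))). ring.
Qed.

Lemma bitE_scal L c G : bitE L (fun s => c * G s) = c * bitE L G.
Proof.
  rewrite (bitE_ext L _ (fun s => c * G s + 0 * G s)) by (intros; lra).
  rewrite bitE_lin. lra.
Qed.

Lemma bitE_const L c : bitE L (fun _ => c) = c.
Proof. induction L as [|[a p] L IH]; simpl; [lra|rewrite IH; lra]. Qed.

Lemma bitE_le p0 L : 0 <= p0 -> probs_in p0 L ->
  forall G G', (forall s, G s <= G' s) -> bitE L G <= bitE L G'.
Proof.
  intros H0. induction L as [|[a p] L IH]; intros HL G G' H; simpl; [apply H|].
  apply probs_in_cons in HL as [Hp HL].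
  apply Rplus_le_compat; apply Rmult_le_compat_l; try lra; apply IH; auto.
Qed.

Lemma bitE_app L1 L2 : forall G,
  bitE (L1 ++ L2) G = bitE L1 (fun s => bitE L2 (fun s' => G (s + s'))).
Proof.
  induction L1 as [|[a p] L IH]; intros G; simpl.
  - apply bitE_ext. intros; f_equal; lra.
  - rewrite !IH. f_equal. f_equal.
    apply bitE_ext; intros; apply bitE_ext; intros; f_equal; lra.
Qed.

Lemma bitE_perm L L' : Permutation L L' -> forall G, bitE L G = bitE L' G.
Proof.
  induction 1 as [|[a p] L L' _ IH|[a p] [b q] L|L L' L'' _ IH1 _ IH2]; intros G; simpl.
  - reflexivity.
  - now rewrite !IH.
  - rewrite (bitE_ext L (fun s => G (b + (a + s))) (fun s => G (a + (b + s))))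
      by (intros; f_equal; lra). ring.
  - now rewrite IH1.
Qed.

(* Independent summands can only decrease concentration. *)
Lemma bitE_sub_le p0 L L1 L2 G M : 0 <= p0 -> probs_in p0 L ->
  Permutation L (L2 ++ L1) ->
  (forall c, bitE L1 (fun s => G (c + s)) <= M) -> bitE L G <= M.
Proof.
  intros H0 HL HP H. rewrite (bitE_perm _ _ HP), bitE_app.
  rewrite <- (bitE_const L2 M). apply bitE_le with p0; auto.
  intros a p Hin. apply (HL a). apply (Permutation_in _ (Permutation_sym HP)).
  apply in_or_app; now left.
Qed.

Lemma filter_split_perm {A} (q : A -> bool) l :
  Permutation l (filter (fun a => negb (q a)) l ++ filter q l).
Proof.
  induction l as [|a l IH]; simpl; [constructor|].
  destruct (q a); simpl; [|now constructor].
  eapply perm_trans; [apply perm_skip, IH|]. apply Permutation_middle.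
Qed.

(** * Separated weights *)

(** Each weight outweighs all later ones together by more than [eta], so its two bit values lead to
    ranges of the sum that are more than [eta] apart. *)
Fixpoint separated (eta : R) (l : list R) : Prop :=
  match l with
  | [] => True
  | a :: l' => eta + sumR l' Rabs < Rabs a /\ separated eta l'
  end.

(** The sum of the bits lies between the total of the negative weights and that of the positive
    ones. The offset [lo] absorbs the translation of [G] when the first bit is 1. *)
Lemma bitE_vanish L : forall G lo,
  (forall s, lo + sumR L (fun ap => Rmin 0 (fst ap)) <= s
             <= lo + sumR L (fun ap => Rmax 0 (fst ap)) -> G (s - lo) = 0) ->
  bitE L G = 0.
Proof.
  induction L as [|[a p] L IH]; intros G lo H; simpl in *.
  - replace 0 with (lo - lo) at 1 by lra. apply H. lra.
  - rewrite (IH G lo), (IH (fun s => G (a + s)) (lo + a)); [lra| |].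
    + intros s Hs. replace (a + (s - (lo + a))) with (s - lo) by lra. apply H.
      unfold Rmin, Rmax in *.
      destruct (Rle_dec 0 a); lra.
    + intros s Hs. apply H. unfold Rmin, Rmax in *. destruct (Rle_dec 0 a); lra.
Qed.

(* The window cannot be hit for both values of the largest bit, so each bit costs a
   factor [1 - p0]. *)
Lemma bitE_separated p0 eta L : 0 <= p0 -> probs_in p0 L ->
  separated eta (map fst L) ->
  forall G c, (forall s, 0 <= G s <= 1) ->
    (forall s, G s <> 0 -> c <= s <= c + eta) ->
    bitE L G <= (1 - p0) ^ length L.
Proof.
  intros H0. induction L as [|[a p] L IH]; intros HL Hs G c HG Hc.
  - simpl. apply HG.
  - apply probs_in_cons in HL as [Hp HL]. destruct Hs as [Ha Hs].
    cbn [length pow bitE].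
    assert (I1 : bitE L G <= (1 - p0) ^ length L) by (apply IH with c; auto).
    assert (I2 : bitE L (fun s => G (a + s)) <= (1 - p0) ^ length L).
    { apply IH with (c - a); auto. intros s Hne. apply Hc in Hne. lra. }
    assert (P : 0 <= (1 - p0) ^ length L) by (apply pow_le; lra).
    set (lo := sumR L (fun ap => Rmin 0 (fst ap))).
    set (hi := sumR L (fun ap => Rmax 0 (fst ap))).
    assert (E : sumR (map fst L) Rabs = hi - lo).
    { unfold hi, lo. rewrite sumR_map, <- sumR_minus. apply sumR_ext. intros [b q] _. simpl.
      unfold Rmin, Rmax, Rabs. destruct (Rle_dec 0 b), (Rcase_abs b); lra. }
    cbn [map fst] in Ha. rewrite E in Ha.
    assert (Z0 : (forall s, lo <= s <= hi -> ~ (c <= s <= c + eta)) -> bitE L G = 0).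
    { intros H. apply bitE_vanish with 0. intros s Hr. fold lo hi in Hr.
      destruct (Req_dec (G (s - 0)) 0) as [|Hne]; auto. apply Hc in Hne.
      exfalso. apply (H s); lra. }
    assert (Z1 : (forall s, lo <= s <= hi -> ~ (c <= a + s <= c + eta)) ->
                 bitE L (fun s => G (a + s)) = 0).
    { intros H. apply bitE_vanish with 0. intros s Hr. fold lo hi in Hr.
      destruct (Req_dec (G (a + (s - 0))) 0) as [|Hne]; auto. apply Hc in Hne.
      exfalso. apply (H s); lra. }
    (* If the window met both [[lo, hi]] and its translate by [a], then [Rabs a <= eta + (hi - lo)],
       against separation. The surviving branch has probability at most [1 - p0]. *)
    assert (D : bitE L G = 0 \/ bitE L (fun s => G (a + s)) = 0).
    { destruct (Rlt_dec hi c) as [?|A1]; [left; apply Z0; intros; lra|].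
      destruct (Rlt_dec (c + eta) lo) as [?|A2]; [left; apply Z0; intros; lra|].
      right. apply Z1. intros s Hr Hw. unfold Rabs in Ha.
      destruct (Rcase_abs a); lra. }
    destruct D as [D|D]; rewrite D; nra.
Qed.

(** The invariant is that [eta] plus all later weights is at most half the current weight: one step
    back gives at most [(1 + 1/2) / 4 = 3/8] of the preceding weight. Positivity of the last weight
    makes the domination strict. *)
Lemma separated_geometric (f : nat -> R) eta m st :
  (forall l, (st <= l)%nat -> (S l < st + S m)%nat -> Rabs (f (S l)) <= Rabs (f l) / 4) ->
  eta <= Rabs (f (st + m)%nat) / 2 -> 0 < Rabs (f (st + m)%nat) ->
  separated eta (map f (seq st (S m))) /\
  eta + sumR (map f (seq (S st) m)) Rabs <= Rabs (f st) / 2 /\ 0 < Rabs (f st).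
Proof.
  revert st. induction m as [|m IH]; intros st H He Hp.
  - rewrite Nat.add_0_r in *. simpl. repeat split; lra.
  - destruct (IH (S st)) as [I1 [I2 I3]].
    + intros l Hl Hl'. apply H; lia.
    + replace (S st + m)%nat with (st + S m)%nat by lia. auto.
    + replace (S st + m)%nat with (st + S m)%nat by lia. auto.
    + assert (Q : Rabs (f (S st)) <= Rabs (f st) / 4) by (apply H; lia).
      assert (Q' : eta + sumR (map f (seq (S st) (S m))) Rabs <= Rabs (f st) / 2).
      { cbn [seq map]. rewrite sumR_cons. lra. }
      split; [|split; [exact Q'|lra]].
      change (map f (seq st (S (S m)))) with (f st :: map f (seq (S st) (S m))).
      cbn [separated]. split; [lra|exact I1].
Qed.

(** * Anti-concentration by the Fejer kernel *)

(** Multiplication of the characteristic function by a phase, in real and imaginary parts. *)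
Lemma bitE_cos_sin_add L xi : forall s0,
  bitE L (fun s => cos (xi * (s0 + s)))
  = cos (xi * s0) * bitE L (fun s => cos (xi * s)) - sin (xi * s0) * bitE L (fun s => sin (xi * s))
  /\ bitE L (fun s => sin (xi * (s0 + s)))
  = sin (xi * s0) * bitE L (fun s => cos (xi * s)) + cos (xi * s0) * bitE L (fun s => sin (xi * s)).
Proof.
  intros s0. split.
  - rewrite (bitE_ext L _ (fun s => cos (xi * s0) * cos (xi * s) + - sin (xi * s0) * sin (xi * s))).
    + rewrite bitE_lin. lra.
    + intros s. rewrite Rmult_plus_distr_l, cos_plus. lra.
  - rewrite (bitE_ext L _ (fun s => sin (xi * s0) * cos (xi * s) + cos (xi * s0) * sin (xi * s))).
    + rewrite bitE_lin. lra.
    + intros s. rewrite Rmult_plus_distr_l, sin_plus. lra.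
Qed.

Lemma one_sub_cos_ge x : Rabs x <= 1 -> x^2 / 4 <= 1 - cos x.
Proof.
  intros Hx. assert (Hx' : -1 <= x <= 1) by (unfold Rabs in Hx; destruct (Rcase_abs x); lra).
  (* The Taylor bound of degree 4: [cos x <= 1 - x^2/2 + x^4/24]. *)
  assert (B : cos x <= cos_approx x (2 * (0 + 1))).
  { apply (pre_cos_bound x 0); lra. }
  unfold cos_approx, cos_term in B. simpl in B.
  assert (0 <= x * x <= 1) by nra.
  assert (x * x * (x * x) <= x * x) by nra. lra.
Qed.

(** The squared modulus is multiplicative over the bits. One bit contributes
    [1 - 2p(1-p)(1 - cos(xi a))], which is at most [1 - p0 (xi a)^2 / 4] and so at most the
    exponential of [- p0 (xi a)^2 / 4]. *)
Lemma char_fun_sqr_le p0 xi L : 0 <= p0 <= / 2 -> probs_in p0 L ->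
  (forall a p, In (a, p) L -> Rabs (xi * a) <= 1) ->
  (bitE L (fun s => cos (xi * s)))^2 + (bitE L (fun s => sin (xi * s)))^2
  <= exp (- (p0 * xi^2 / 4 * sumR L (fun ap => (fst ap)^2))).
Proof.
  intros Hp0. induction L as [|[a p] L IH]; intros HL Ha.
  - simpl. rewrite !Rmult_0_r, cos_0, sin_0, Ropp_0, exp_0. lra.
  - apply probs_in_cons in HL as [Hp HL].
    rewrite sumR_cons. cbn [bitE fst].
    destruct (bitE_cos_sin_add L xi a) as [-> ->].
    assert (IH' : (bitE L (fun s => cos (xi * s)))^2 + (bitE L (fun s => sin (xi * s)))^2
              <= exp (- (p0 * xi^2 / 4 * sumR L (fun ap => (fst ap)^2)))).
    { apply IH; auto. intros b q Hb. apply (Ha b q). now right. }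
    clear IH. revert IH'.
    set (u := bitE L (fun s => cos (xi * s))). set (v := bitE L (fun s => sin (xi * s))).
    set (V := sumR L (fun ap => (fst ap)^2)). intros IH.
    assert (T := sin2_cos2 (xi * a)). unfold Rsqr in T.
    assert (K : (xi * a)^2 / 4 <= 1 - cos (xi * a))
      by (apply one_sub_cos_ge, (Ha a p); now left).
    set (c := cos (xi * a)) in *. set (d := sin (xi * a)) in *.
    (* The term in [d * d + c * c - 1] is zero; carrying it makes the identity provable by
       [ring]. *)
    replace (((1 - p) * u + p * (c * u - d * v))^2 + ((1 - p) * v + p * (d * u + c * v))^2)
      with ((1 - 2 * p * (1 - p) * (1 - c)) * (u^2 + v^2)
            + p^2 * (d * d + c * c - 1) * (u^2 + v^2)) by ring.
    replace (d * d + c * c - 1) with 0 by lra.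
    replace (- (p0 * xi^2 / 4 * (a^2 + V)))
      with (- (p0 * (xi * a)^2 / 4) + - (p0 * xi^2 / 4 * V)) by field.
    rewrite exp_plus.
    assert (P : p0 / 2 <= p * (1 - p)) by nra.
    assert (P' : p0 * (xi * a)^2 / 4 <= 2 * p * (1 - p) * (1 - c)).
    { assert (0 <= (xi * a)^2) by apply pow2_ge_0.
      assert (0 <= (p * (1 - p) - p0 / 2) * (1 - c)) by (apply Rmult_le_pos; lra).
      assert (0 <= p0 * (1 - c - (xi * a)^2 / 4)) by (apply Rmult_le_pos; lra). nra. }
    assert (EE := exp_ineq1_le (- (p0 * (xi * a)^2 / 4))).
    apply Rle_trans with (exp (- (p0 * (xi * a)^2 / 4)) * (u^2 + v^2)).
    + assert (0 <= u^2 + v^2) by nra.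
      replace ((1 - 2 * p * (1 - p) * (1 - c)) * (u ^ 2 + v ^ 2) + p ^ 2 * 0 * (u ^ 2 + v ^ 2))
        with ((1 - 2 * p * (1 - p) * (1 - c)) * (u ^ 2 + v ^ 2)) by ring.
      apply Rmult_le_compat_r; lra.
    + apply Rmult_le_compat_l; [left; apply exp_pos|exact IH].
Qed.

(** This is [(1 - cos x) / x^2] for nonzero [x]. The integral form uses only frequencies in [[0,1]],
    where the bound on the characteristic function applies after rescaling. *)
Definition fejer (x : R) : R := RInt (fun xi => (1 - xi) * cos (xi * x)) 0 1.

Lemma ex_RInt_fejer x : ex_RInt (fun xi => (1 - xi) * cos (xi * x)) 0 1.
Proof.
  apply (ex_RInt_continuous (V := R_CompleteNormedModule)). intros z _.
  apply (ex_derive_continuous (K := R_AbsRing) (V := R_NormedModule)). auto_derive. auto.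
Qed.

(** For [Rabs x <= 1] every cosine in the integrand is at least 1/2, and [(1 - xi) / 2] integrates
    to 1/4. *)
Lemma fejer_ge x : Rabs x <= 1 -> / 4 <= fejer x.
Proof.
  intros Hx.
  assert (I : is_RInt (fun xi : R => (1 - xi) / 2) 0 1 (/ 4)).
  { replace (/ 4) with (minus ((1 / 2 - 1 ^ 2 / 4)) (0 / 2 - 0 ^ 2 / 4))
      by (unfold minus, plus, opp; simpl; lra).
    apply (is_RInt_derive (fun t => t / 2 - t ^ 2 / 4) (fun xi => (1 - xi) / 2)).
    - intros t _. auto_derive; auto. lra.
    - intros t _. apply (ex_derive_continuous (K := R_AbsRing) (V := R_NormedModule)).
      auto_derive. auto. }
  rewrite <- (is_RInt_unique _ _ _ _ I). unfold fejer.
  apply RInt_le; [lra|eexists; exact I|apply ex_RInt_fejer|].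
  intros t Ht.
  assert (/ 2 <= cos (t * x)).
  { assert (Hx' : -1 <= x <= 1) by (unfold Rabs in Hx; destruct (Rcase_abs x); lra).
    assert (B : cos_approx (t * x) (2 * 0 + 1) <= cos (t * x)).
    { apply (pre_cos_bound (t * x) 0); nra. }
    unfold cos_approx, cos_term in B. simpl in B.
    assert (-1 <= t * x <= 1) by nra.
    assert (t * x * (t * x) <= 1) by nra. lra. }
  nra.
Qed.

(** Integration by parts gives the closed form [(1 - cos x) / x^2]; the value at 0 comes from
    [fejer_ge]. *)
Lemma fejer_nonneg x : 0 <= fejer x.
Proof.
  destruct (Req_dec x 0) as [->|Hx].
  - assert (/ 4 <= fejer 0) by (apply fejer_ge; rewrite Rabs_R0; lra). lra.
  - assert (I : is_RInt (fun xi : R => (1 - xi) * cos (xi * x)) 0 1 ((1 - cos x) / x^2)).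
    { set (F := fun t : R => (1 - t) * sin (t * x) / x - cos (t * x) / x^2).
      replace ((1 - cos x) / x^2) with (minus (F 1) (F 0)).
      2:{ unfold F, minus, plus, opp; simpl. rewrite Rmult_0_l, Rmult_1_l, cos_0, sin_0. field. auto. }
      apply (is_RInt_derive F).
      - intros t _. unfold F. auto_derive; auto. field. auto.
      - intros t _. apply (ex_derive_continuous (K := R_AbsRing) (V := R_NormedModule)).
        auto_derive. auto. }
    unfold fejer. rewrite (is_RInt_unique _ _ _ _ I).
    apply Rdiv_le_0_compat; [assert (H := COS_bound x); lra|nra].
Qed.

Lemma bitE_continuous L : forall (f : R -> R -> R),
  (forall s z, continuous (fun xi => f xi s) z) ->
  forall z, continuous (fun xi => bitE L (f xi)) z.
Proof.
  induction L as [|[a p] L IH]; intros f Hf z; simpl; [apply Hf|].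
  apply (continuous_plus (V := R_NormedModule)).
  - apply (continuous_scal_r (V := R_NormedModule) (1 - p)). now apply IH.
  - apply (continuous_scal_r (V := R_NormedModule) p).
    apply (IH (fun xi s => f xi (a + s))). auto.
Qed.

Lemma bitE_RInt L : forall (f : R -> R -> R),
  (forall s z, continuous (fun xi => f xi s) z) ->
  bitE L (fun s => RInt (fun xi => f xi s) 0 1) = RInt (fun xi => bitE L (f xi)) 0 1.
Proof.
  induction L as [|[a p] L IH]; intros f Hf; simpl; [reflexivity|].
  rewrite (IH f Hf), (IH (fun xi s => f xi (a + s))) by auto.
  assert (E1 : ex_RInt (fun xi => bitE L (f xi)) 0 1)
    by (apply (ex_RInt_continuous (V := R_CompleteNormedModule)); intros; now apply bitE_continuous).
  assert (E2 : ex_RInt (fun xi => bitE L (fun s => f xi (a + s))) 0 1).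
  { apply (ex_RInt_continuous (V := R_CompleteNormedModule)); intros.
    apply (bitE_continuous L (fun xi s => f xi (a + s))); auto. }
  symmetry. apply is_RInt_unique.
  apply (is_RInt_plus (V := R_NormedModule)).
  - apply (is_RInt_scal (V := R_NormedModule)). now apply (RInt_correct (V := R_CompleteNormedModule)).
  - apply (is_RInt_scal (V := R_NormedModule)). now apply (RInt_correct (V := R_CompleteNormedModule)).
Qed.

(** The rational function stands in for a Gaussian: it has the antiderivative
    [atan (beta * t) / beta], and [atan] stays below [PI / 2 <= 2]. *)
Lemma RInt_atan_le beta : 0 < beta ->
  ex_RInt (fun xi => / (1 + (beta * xi)^2)) 0 1 /\
  RInt (fun xi => / (1 + (beta * xi)^2)) 0 1 <= 2 / beta.
Proof.
  intros Hb.
  assert (I : is_RInt (fun xi => / (1 + (beta * xi)^2)) 0 1 (atan beta / beta)).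
  { replace (atan beta / beta)
      with (minus (atan (beta * 1) / beta) (atan (beta * 0) / beta)).
    2:{ unfold minus, plus, opp; simpl. rewrite Rmult_1_r, Rmult_0_r, atan_0. field. lra. }
    apply (is_RInt_derive (fun t => atan (beta * t) / beta)).
    - intros t _. auto_derive; auto. unfold Rsqr. field. split; [nra|lra].
    - intros t _. apply (ex_derive_continuous (K := R_AbsRing) (V := R_NormedModule)).
      auto_derive. nra. }
  split; [eexists; exact I|]. rewrite (is_RInt_unique _ _ _ _ I).
  apply Rmult_le_compat_r; [left; now apply Rinv_0_lt_compat|].
  assert (A := atan_bound beta). assert (P := PI_4). lra.
Qed.

Definition near (c r s : R) : R := if Rle_dec (Rabs (s - c)) r then 1 else 0.

(* Esseen-type bound: dominate the indicator by the Fejer kernel and integrate the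
   characteristic function. *)
Lemma bitE_concentration p0 lam beta L c : 0 <= p0 <= / 2 -> probs_in p0 L ->
  0 < lam -> 0 < beta -> (forall a p, In (a, p) L -> Rabs a <= lam) ->
  8 * lam^2 * beta^2 <= p0 * sumR L (fun ap => (fst ap)^2) ->
  bitE L (near c lam) <= 8 / beta.
Proof.
  intros Hp0 HL Hl Hb Ha HV.
  (* The factor 4 compensates the lower bound 1/4 of the kernel on the window. *)
  apply Rle_trans with (bitE L (fun s => 4 * fejer ((s - c) / lam))).
  { apply bitE_le with p0; [lra|auto|]. intros s. unfold near.
    destruct (Rle_dec (Rabs (s - c)) lam) as [H|H].
    - assert (/ 4 <= fejer ((s - c) / lam)); [|lra]. apply fejer_ge.
      unfold Rdiv. rewrite Rabs_mult, Rabs_inv, (Rabs_right lam) by lra.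
      apply Rmult_le_reg_r with lam; [lra|]. rewrite Rmult_assoc, Rinv_l; lra.
    - assert (F := fejer_nonneg ((s - c) / lam)). lra. }
  rewrite bitE_scal. replace (8 / beta) with (4 * (2 / beta)) by (field; lra).
  apply Rmult_le_compat_l; [lra|].
  unfold fejer.
  assert (C : forall s z, continuous (fun xi => (1 - xi) * cos (xi * ((s - c) / lam))) z).
  { intros s z. apply (ex_derive_continuous (K := R_AbsRing) (V := R_NormedModule)).
    auto_derive. auto. }
  rewrite (bitE_RInt L (fun xi s => (1 - xi) * cos (xi * ((s - c) / lam)))) by exact C.
  destruct (RInt_atan_le beta Hb) as [Ex Le].
  eapply Rle_trans; [|exact Le].
  apply RInt_le; [lra| |exact Ex|].
  { apply (ex_RInt_continuous (V := R_CompleteNormedModule)). intros z _.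
    apply (bitE_continuous L (fun xi s => (1 - xi) * cos (xi * ((s - c) / lam)))), C. }
  intros xi Hxi. rewrite bitE_scal.
  set (phi := xi / lam * - c).
  rewrite (bitE_ext L _ (fun s => cos phi * cos (xi / lam * s) + - sin phi * sin (xi / lam * s))).
  2:{ intros s. replace (xi * ((s - c) / lam)) with (phi + xi / lam * s) by (unfold phi; field; lra).
      rewrite cos_plus. lra. }
  rewrite bitE_lin.
  assert (S := char_fun_sqr_le p0 (xi / lam) L Hp0 HL).
  set (u := bitE L (fun s => cos (xi / lam * s))) in *.
  set (v := bitE L (fun s => sin (xi / lam * s))) in *.
  set (V := sumR L (fun ap => (fst ap)^2)) in *.
  set (E := / (1 + (beta * xi)^2)).
  assert (HE : 0 < E) by (apply Rinv_0_lt_compat; nra).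
  (* The variance hypothesis bounds the squared modulus by [exp (-2 (beta xi)^2)], hence the modulus
     by [exp (-(beta xi)^2) <= E]. *)
  assert (S2 : u^2 + v^2 <= E^2).
  { eapply Rle_trans; [apply S|].
    - intros a p Hin. rewrite Rabs_mult. apply Ha in Hin.
      assert (Rabs (xi / lam) <= / lam).
      { unfold Rdiv. rewrite Rabs_mult, Rabs_inv, (Rabs_right lam), (Rabs_right xi) by lra.
        assert (0 < / lam) by (apply Rinv_0_lt_compat; lra). nra. }
      replace 1 with (/ lam * lam) by (field; lra).
      apply Rmult_le_compat; auto; apply Rabs_pos.
    - apply Rle_trans with (exp (- (2 * (beta * xi)^2))).
      + assert (Q : 2 * (beta * xi)^2 <= p0 * (xi / lam)^2 / 4 * V).
        { replace (p0 * (xi / lam)^2 / 4 * V) with (xi^2 / (4 * lam^2) * (p0 * V)) by (field; lra).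
          apply Rle_trans with (xi^2 / (4 * lam^2) * (8 * lam^2 * beta^2)).
          - right. field. lra.
          - apply Rmult_le_compat_l; [|exact HV].
            apply Rdiv_le_0_compat; nra. }
        destruct (Rle_lt_or_eq_dec _ _ Q) as [Q'|Q'];
          [left; apply exp_increasing; lra|right; f_equal; lra].
      + replace (- (2 * (beta * xi)^2)) with (- (beta * xi)^2 + - (beta * xi)^2) by ring.
        rewrite exp_plus.
        assert (G : exp (- (beta * xi)^2) <= E).
        { rewrite exp_Ropp. apply Rinv_le_contravar; [nra|]. apply exp_ineq1_le. }
        assert (0 < exp (- (beta * xi)^2)) by apply exp_pos. nra. }
  assert (T := sin2_cos2 phi). unfold Rsqr in T.
  (* A rotation by [phi] preserves [u^2 + v^2], so one coordinate of the rotated vector is at most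
     its length. *)
  assert (W : cos phi * u + - sin phi * v <= E).
  { apply Rsqr_incr_0_var; [|lra]. unfold Rsqr.
    assert (0 <= (sin phi * u + cos phi * v)^2) by apply pow2_ge_0.
    assert ((cos phi * u + - sin phi * v) * (cos phi * u + - sin phi * v)
            + (sin phi * u + cos phi * v)^2
            = (sin phi * sin phi + cos phi * cos phi) * (u^2 + v^2)) by ring.
    rewrite T in *. lra. }
  destruct (Rle_dec 0 (cos phi * u + - sin phi * v)); nra.
Qed.

(** * Sums over bit vectors and lists of columns *)

Lemma in_lists_of {A} (l : list A) n : forall v, In v (lists_of l n) ->
  length v = n /\ forall a, In a v -> In a l.
Proof.
  induction n as [|n IH]; intros v Hv; simpl in Hv.
  - destruct Hv as [<-|[]]. simpl; intuition.
  - apply in_flat_map in Hv as [v' [Hv' Hin]]. apply in_map_iff in Hin as [a [<- Ha]].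
    destruct (IH _ Hv') as [E H]. split; [simpl; congruence|].
    intros b [<-|Hb]; auto.
Qed.

Lemma sumR_bvecs_S n f :
  sumR (bvecs (S n)) f = sumR (bvecs n) (fun v => f (false :: v) + f (true :: v)).
Proof. simpl. rewrite sumR_flat_map. apply sumR_ext; intros; simpl; lra. Qed.

Lemma sumR_lists_of_S {A} (l : list A) n f :
  sumR (lists_of l (S n)) f = sumR l (fun a => sumR (lists_of l n) (fun v => f (a :: v))).
Proof.
  simpl. rewrite sumR_flat_map, sumR_swap. apply sumR_ext; intros. now rewrite sumR_map.
Qed.

Lemma prodR_nth {A} (f : A -> R) (d : A) v :
  prodR v f = prodR (seq 0 (length v)) (fun j => f (nth j v d)).
Proof.
  induction v as [|a v IH]; [reflexivity|]. cbn [length]. rewrite prodR_seq_S.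
  unfold prodR at 1. simpl. fold (prodR v f). now rewrite IH.
Qed.

(** * Independent columns *)

(* E[G(sum of A j c_j)] for independent columns c_j of distribution mu j. *)
Fixpoint colE (cs : list (list bool)) (n : nat) (mu A : nat -> list bool -> R)
  (G : R -> R) : R :=
  match n with
  | O => G 0
  | S n' => sumR cs (fun c => mu O c *
      colE cs n' (fun j => mu (S j)) (fun j => A (S j)) (fun s => G (A O c + s)))
  end.

Lemma sumR_lists_of_colE cs n : forall mu A G,
  sumR (lists_of cs n) (fun y => prodR (seq 0 n) (fun j => mu j (nth j y []))
     * G (sumR (seq 0 n) (fun j => A j (nth j y [])))) = colE cs n mu A G.
Proof.
  induction n as [|n IH]; intros mu A G.
  - simpl. unfold prodR; simpl. lra.
  - rewrite sumR_lists_of_S. cbn [colE]. apply sumR_ext; intros c _.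
    rewrite <- IH, <- sumR_scal. apply sumR_ext; intros v _.
    rewrite prodR_seq_S, sumR_seq_S. simpl. lra.
Qed.

Lemma sumR_prodR_lists_of cs n : forall (g : nat -> list bool -> R),
  sumR (lists_of cs n) (fun y => prodR (seq 0 n) (fun j => g j (nth j y [])))
  = prodR (seq 0 n) (fun j => sumR cs (g j)).
Proof.
  induction n as [|n IH]; intros g.
  - simpl. unfold prodR; simpl. lra.
  - rewrite sumR_lists_of_S, prodR_seq_S, <- (IH (fun j => g (S j))), <- sumR_scal_r.
    apply sumR_ext; intros c _. rewrite <- sumR_scal. apply sumR_ext; intros v _.
    now rewrite prodR_seq_S.
Qed.

Lemma sumR_prodR_bvecs n : forall (g : nat -> bool -> R),
  sumR (bvecs n) (fun c => prodR (seq 0 n) (fun i => g i (nth i c false)))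
  = prodR (seq 0 n) (fun i => g i false + g i true).
Proof.
  induction n as [|n IH]; intros g.
  - simpl. unfold prodR; simpl. lra.
  - rewrite sumR_bvecs_S, prodR_seq_S, <- (IH (fun i => g (S i))), <- sumR_scal.
    apply sumR_ext; intros c _. rewrite !prodR_seq_S. simpl. lra.
Qed.

Definition is_law (cs : list (list bool)) (nu : list bool -> R) : Prop :=
  (forall c, In c cs -> 0 <= nu c) /\ sumR cs nu = 1.

Lemma colE_sum cs n (mu : nat -> list bool -> R) : forall A (B : Type)
  (l : list B) (f : B -> R) (G : B -> R -> R),
  colE cs n mu A (fun s => sumR l (fun b => f b * G b s))
  = sumR l (fun b => f b * colE cs n mu A (G b)).
Proof.
  revert mu. induction n as [|n IH]; intros mu A B l f G; [reflexivity|]. cbn [colE].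
  transitivity (sumR cs (fun c => sumR l (fun b => mu O c * (f b *
    colE cs n (fun j => mu (S j)) (fun j => A (S j)) (fun s => G b (A O c + s)))))).
  - apply sumR_ext; intros c _. rewrite IH, <- sumR_scal. reflexivity.
  - rewrite sumR_swap. apply sumR_ext; intros b _. rewrite <- sumR_scal.
    apply sumR_ext; intros; ring.
Qed.

Lemma sumR_law_abs_le cs nu F e : is_law cs nu -> (forall c, In c cs -> Rabs (F c) <= e) ->
  Rabs (sumR cs (fun c => nu c * F c)) <= e.
Proof.
  intros [Hn H1] HF. eapply Rle_trans; [apply sumR_abs|].
  apply Rle_trans with (sumR cs (fun c => nu c * e)).
  - apply sumR_le; intros c Hc. rewrite Rabs_mult, (Rabs_right (nu c)) by (apply Rle_ge; auto).
    apply Rmult_le_compat_l; auto.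
  - rewrite sumR_scal_r, H1. lra.
Qed.

Lemma colE_abs_le cs nu n : is_law cs nu -> forall A G e, (forall s, Rabs (G s) <= e) ->
  Rabs (colE cs n (fun _ => nu) A G) <= e.
Proof.
  intros Hl. induction n as [|n IH]; intros A G e HG; simpl; [apply HG|].
  apply sumR_law_abs_le; auto.
Qed.

(** The hybrid argument: the columns change law one at a time. The bound for one column is uniform
    in the shift [s], which stands for the contribution of all the others. *)
Lemma lindeberg cs nu0 nu1 n : is_law cs nu0 -> is_law cs nu1 -> forall A G (e : nat -> R),
  (forall j s, (j < n)%nat ->
     Rabs (sumR cs (fun c => nu0 c * G (s + A j c)) - sumR cs (fun c => nu1 c * G (s + A j c))) <= e j) ->
  Rabs (colE cs n (fun _ => nu0) A G - colE cs n (fun _ => nu1) A G) <= sumR (seq 0 n) e.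
Proof.
  intros L0 L1. induction n as [|n IH]; intros A G e H.
  - simpl. rewrite Rminus_diag, Rabs_R0. lra.
  - rewrite sumR_seq_S. cbn [colE].
    set (A' := fun j => A (S j)).
    set (X := fun nu c => colE cs n (fun _ => nu) A' (fun s => G (A O c + s))).
    (* The first term exchanges column 0 while the others already follow [nu1]; the second exchanges
       the others while column 0 still follows [nu0]. *)
    replace (sumR cs (fun c => nu0 c * colE cs n (fun _ => nu0) A' (fun s => G (A O c + s)))
      - sumR cs (fun c => nu1 c * colE cs n (fun _ => nu1) A' (fun s => G (A O c + s))))
      with (colE cs n (fun _ => nu1) A' (fun s => sumR cs (fun c => (nu0 c - nu1 c) * G (A O c + s)))
        + sumR cs (fun c => nu0 c * (X nu0 c - X nu1 c))).
    + eapply Rle_trans; [apply Rabs_triang|]. apply Rplus_le_compat.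
      * apply colE_abs_le; auto. intros s.
        specialize (H O s ltac:(lia)). rewrite <- sumR_minus in H.
        erewrite sumR_ext; [exact H|]. intros c _. cbv beta. rewrite (Rplus_comm s). ring.
      * apply sumR_law_abs_le; auto. intros c _. apply IH. intros j s Hj.
        specialize (H (S j) (A O c + s) ltac:(lia)).
        rewrite (sumR_ext cs _ (fun c0 => nu0 c0 * G (A O c + s + A (S j) c0))),
          (sumR_ext cs (fun c0 => nu1 c0 * G (A O c + (s + A' j c0)))
             (fun c0 => nu1 c0 * G (A O c + s + A (S j) c0))); auto;
          intros; unfold A'; f_equal; f_equal; lra.
    + rewrite (colE_sum cs n (fun _ => nu1) A' _ cs (fun c => nu0 c - nu1 c) (fun c s => G (A O c + s))).
      rewrite <- sumR_plus, <- sumR_minus. apply sumR_ext. intros c _. unfold X. ring.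
Qed.

(** * Moments and noise *)

Definition colsum (k : nat) (u : nat -> R) (c : list bool) : R :=
  sumR (seq 0 k) (fun i => u i * b2R (nth i c false)).

Definition monomial (S : list nat) (x : list bool) : R :=
  fold_right (fun i acc => b2R (nth i x false) * acc) 1 S.

Lemma b2R_idem b : b2R b * b2R b = b2R b.
Proof. destruct b; simpl; lra. Qed.

Lemma monomial_absorb a S x : In a S -> b2R (nth a x false) * monomial S x = monomial S x.
Proof.
  induction S as [|b S IH]; intros Ha; [easy|]. simpl. fold (monomial S x).
  destruct Ha as [->|Ha].
  - now rewrite <- Rmult_assoc, b2R_idem.
  - rewrite <- (IH Ha) at 2. ring.
Qed.

(** Bits are idempotent, so a multiset can be replaced by its support; only over distinct
    coordinates does the noise factorise. *)
Lemma monomial_nodup S x : monomial (nodup Nat.eq_dec S) x = monomial S x.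
Proof.
  induction S as [|a S IH]; [reflexivity|]. cbn [nodup].
  destruct (in_dec Nat.eq_dec a S) as [H|H].
  - rewrite IH. symmetry. now apply monomial_absorb.
  - simpl. fold (monomial S x). fold (monomial (nodup Nat.eq_dec S) x). now rewrite IH.
Qed.

Lemma monomial_prodR S x : monomial S x = prodR S (fun i => b2R (nth i x false)).
Proof. unfold monomial, prodR. induction S; simpl; congruence. Qed.

Lemma prodR_perm {A} (l l' : list A) f : Permutation l l' -> prodR l f = prodR l' f.
Proof. unfold prodR. induction 1; simpl; try lra; congruence. Qed.

(** Extends the product to all coordinates, the form that [sumR_prodR_bvecs] factorises. *)
Lemma prodR_indicator (S : list nat) k f : NoDup S -> (forall i, In i S -> (i < k)%nat) ->
  prodR S f = prodR (seq 0 k) (fun i => if in_dec Nat.eq_dec i S then f i else 1).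
Proof.
  intros ND H.
  transitivity (prodR (filter (fun i => if in_dec Nat.eq_dec i S then true else false) (seq 0 k)) f).
  - apply prodR_perm, NoDup_Permutation; [auto|apply NoDup_filter, seq_NoDup|].
    intros i. rewrite filter_In, in_seq. 
    destruct (in_dec Nat.eq_dec i S) as [Hi|Hi]; split; [|easy|easy|now intros []].
    specialize (H i Hi). intuition lia.
  - rewrite prodR_filter. apply prodR_ext; intros i _. now destruct (in_dec Nat.eq_dec i S).
Qed.

Lemma noise_sum k a : noise k a false + noise k a true = 1.
Proof. unfold noise. destruct a; simpl; lra. Qed.

Lemma noise_true k a : noise k a true = (1 - 1 / INR k ^ 2) * b2R a + 1 / INR k ^ 2 / 2.
Proof. unfold noise. destruct a; simpl; lra. Qed.

Lemma noise_bounds k a c : (2 <= k)%nat ->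
  / (2 * INR k ^ 2) <= noise k a c <= 1 - / (2 * INR k ^ 2).
Proof.
  intros Hk. assert (K : 2 <= INR k) by (apply (le_INR 2); auto).
  assert (0 < / INR k ^ 2 <= / 4).
  { split; [apply Rinv_0_lt_compat; nra|apply Rinv_le_contravar; nra]. }
  rewrite Rinv_mult. unfold noise, Rdiv. destruct (Bool.eqb a c); lra.
Qed.

Definition noisy (k : nat) (x c : list bool) : R :=
  prodR (seq 0 k) (fun i => noise k (nth i x false) (nth i c false)).

(** The law of one noisy column. *)
Definition nu (k : nat) (D : list bool -> R) (c : list bool) : R :=
  sumR (bvecs k) (fun x => D x * noisy k x c).

Lemma noisy_nonneg k x c : (2 <= k)%nat -> 0 <= noisy k x c.
Proof.
  intros Hk. apply prodR_nonneg. intros i _.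
  assert (H := noise_bounds k (nth i x false) (nth i c false) Hk).
  assert (0 < / (2 * INR k ^ 2)); [|lra].
  assert (K : 2 <= INR k) by (apply (le_INR 2); auto). apply Rinv_0_lt_compat; nra.
Qed.

Lemma prodR_one {A} (l : list A) f : (forall a, In a l -> f a = 1) -> prodR l f = 1.
Proof.
  unfold prodR. induction l; intros H; simpl; [reflexivity|].
  rewrite H, IHl; auto with datatypes. lra.
Qed.

Lemma noisy_sum k x : sumR (bvecs k) (noisy k x) = 1.
Proof.
  unfold noisy. rewrite (sumR_prodR_bvecs k (fun i b => noise k (nth i x false) b)).
  apply prodR_one. intros; apply noise_sum.
Qed.

Lemma nu_law k D : (2 <= k)%nat -> is_distr k D -> is_law (bvecs k) (nu k D).
Proof.
  intros Hk [H0 H1]. split.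
  - intros c _. apply sumR_nonneg. intros x Hx. apply Rmult_le_pos; auto. now apply noisy_nonneg.
  - unfold nu. rewrite sumR_swap, <- H1. apply sumR_ext; intros x _.
    rewrite sumR_scal, noisy_sum. lra.
Qed.

Lemma noisy_monomial k S x : NoDup S -> (forall i, In i S -> (i < k)%nat) ->
  sumR (bvecs k) (fun c => noisy k x c * monomial S c)
  = prodR S (fun i => noise k (nth i x false) true).
Proof.
  intros ND H.
  rewrite (prodR_indicator S k) by auto.
  transitivity (sumR (bvecs k) (fun c => prodR (seq 0 k) (fun i =>
    noise k (nth i x false) (nth i c false)
    * (if in_dec Nat.eq_dec i S then b2R (nth i c false) else 1)))).
  - apply sumR_ext; intros c _. rewrite prodR_mult, monomial_prodR.
    now rewrite (prodR_indicator S k) by auto.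
  - rewrite (sumR_prodR_bvecs k (fun i b => noise k (nth i x false) b
      * (if in_dec Nat.eq_dec i S then b2R b else 1))).
    apply prodR_ext; intros i _. destruct (in_dec Nat.eq_dec i S); simpl; [lra|].
    rewrite !Rmult_1_r. apply noise_sum.
Qed.

(** The affine factors are expanded one by one. An index whose bit is chosen moves from [S] to [U],
    so the joint degree never exceeds 4, and the case of empty [S] is the moment hypothesis. *)
Lemma affine_moments_match k D0 D1 al be : moments_match4 k D0 D1 ->
  forall S U, (length S + length U <= 4)%nat ->
  (forall i, In i S -> (i < k)%nat) -> (forall i, In i U -> (i < k)%nat) ->
  sumR (bvecs k) (fun x => D0 x * (monomial U x * prodR S (fun i => al * b2R (nth i x false) + be)))
  = sumR (bvecs k) (fun x => D1 x * (monomial U x * prodR S (fun i => al * b2R (nth i x false) + be))).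
Proof.
  intros HM. induction S as [|i S IH]; intros U HL HS HU.
  - assert (X : forall D : list bool -> R, sumR (bvecs k) (fun x => D x * (monomial U x
      * prodR [] (fun i => al * b2R (nth i x false) + be))) = moment k D U).
    { intros D. apply sumR_ext; intros x _. unfold prodR; simpl. fold (monomial U x). ring. }
    rewrite !X. apply HM; auto.
  - assert (X : forall D : list bool -> R,
      sumR (bvecs k) (fun x => D x * (monomial U x * prodR (i :: S) (fun i => al * b2R (nth i x false) + be)))
      = al * sumR (bvecs k) (fun x => D x * (monomial (i :: U) x * prodR S (fun i => al * b2R (nth i x false) + be)))
      + be * sumR (bvecs k) (fun x => D x * (monomial U x * prodR S (fun i => al * b2R (nth i x false) + be)))).
    { intros D. rewrite <- !sumR_scal, <- sumR_plus. apply sumR_ext; intros x _.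
      unfold prodR; simpl. fold (monomial U x). ring. }
    rewrite !X. simpl in HL. f_equal; f_equal; apply IH; simpl; auto with datatypes; try lia.
    intros j [<-|Hj]; auto with datatypes.
Qed.

(** Given [x], distinct noisy bits are independent with means affine in the bits of [x], so a noisy
    moment is a combination of original moments of no larger degree. *)
Lemma nu_moments_match k D0 D1 S : moments_match4 k D0 D1 -> (length S <= 4)%nat ->
  (forall i, In i S -> (i < k)%nat) ->
  sumR (bvecs k) (fun c => nu k D0 c * monomial S c) = sumR (bvecs k) (fun c => nu k D1 c * monomial S c).
Proof.
  intros HM HL HS. set (S' := nodup Nat.eq_dec S).
  assert (HS' : forall i, In i S' -> (i < k)%nat)
    by (intros i Hi; apply HS; eapply nodup_In; exact Hi).
  assert (ND : NoDup S') by apply NoDup_nodup.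
  assert (LL : (length S' <= length S)%nat)
    by (apply NoDup_incl_length; auto; intros i Hi; eapply nodup_In; exact Hi).
  assert (X : forall D, sumR (bvecs k) (fun c => nu k D c * monomial S c)
    = sumR (bvecs k) (fun x => D x * (monomial [] x
        * prodR S' (fun i => (1 - 1 / INR k ^ 2) * b2R (nth i x false) + 1 / INR k ^ 2 / 2)))).
  { intros D. unfold nu.
    transitivity (sumR (bvecs k) (fun x => sumR (bvecs k) (fun c => D x * (noisy k x c * monomial S' c)))).
    - rewrite (sumR_swap (bvecs k) (bvecs k) (fun x c => D x * (noisy k x c * monomial S' c))).
      apply sumR_ext; intros c _. unfold S'. rewrite monomial_nodup, <- sumR_scal_r.
      apply sumR_ext; intros; ring.
    - apply sumR_ext; intros x _. rewrite sumR_scal, noisy_monomial by auto. f_equal.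
      simpl. rewrite Rmult_1_l. apply prodR_ext; intros. apply noise_true. }
  rewrite !X. apply affine_moments_match; auto; simpl; [lia|easy].
Qed.

(** Each factor [colsum k t c] is expanded over the rows and adds one index to the monomial, which
    keeps [m + length S] constant. *)
Lemma nu_power_match k D0 D1 t : moments_match4 k D0 D1 -> forall m S,
  (m + length S <= 4)%nat -> (forall i, In i S -> (i < k)%nat) ->
  sumR (bvecs k) (fun c => nu k D0 c * (monomial S c * colsum k t c ^ m))
  = sumR (bvecs k) (fun c => nu k D1 c * (monomial S c * colsum k t c ^ m)).
Proof.
  intros HM. induction m as [|m IH]; intros S HL HS.
  - assert (X : forall D, sumR (bvecs k) (fun c => nu k D c * (monomial S c * colsum k t c ^ 0))
      = sumR (bvecs k) (fun c => nu k D c * monomial S c))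
      by (intros D; apply sumR_ext; intros; simpl; ring).
    rewrite !X. apply nu_moments_match; auto.
  - assert (X : forall D, sumR (bvecs k) (fun c => nu k D c * (monomial S c * colsum k t c ^ Datatypes.S m))
      = sumR (seq 0 k) (fun i => t i *
          sumR (bvecs k) (fun c => nu k D c * (monomial (i :: S) c * colsum k t c ^ m)))).
    { intros D. rewrite (sumR_ext (seq 0 k) _ (fun i => sumR (bvecs k)
        (fun c => t i * (nu k D c * (monomial (i :: S) c * colsum k t c ^ m)))))
        by (intros; now rewrite sumR_scal).
      rewrite sumR_swap. apply sumR_ext; intros c _.
      transitivity (nu k D c * (monomial S c * colsum k t c ^ m) * colsum k t c); [simpl; ring|].
      unfold colsum at 2. rewrite <- sumR_scal. apply sumR_ext; intros i _. simpl. fold (monomial S c). ring. }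
    rewrite !X. apply sumR_ext; intros i Hi. f_equal. apply IH; simpl; [lia|].
    intros j [<-|Hj]; [apply in_seq in Hi; lia|auto].
Qed.

(* A function of a single bit is affine, so the cubic Taylor polynomial in the tail has
   degree at most 4 in the column. *)
Lemma column_exchange k D0 D1 (a : R) i0 t G g1 g2 g3 E s :
  (2 <= k)%nat -> is_distr k D0 -> is_distr k D1 -> moments_match4 k D0 D1 -> (i0 < k)%nat ->
  (forall b c, In c (bvecs k) -> let x := colsum k t c in
     Rabs (G (b + x) - (G b + g1 b * x + g2 b * x^2 + g3 b * x^3)) <= E) ->
  Rabs (sumR (bvecs k) (fun c => nu k D0 c * G (s + (a * b2R (nth i0 c false) + colsum k t c)))
      - sumR (bvecs k) (fun c => nu k D1 c * G (s + (a * b2R (nth i0 c false) + colsum k t c))))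
  <= 2 * E.
Proof.
  intros Hk HD0 HD1 HM Hi HT.
  set (B := fun c => s + a * b2R (nth i0 c false)).
  set (X := colsum k t).
  set (P := fun c => G (B c) + g1 (B c) * X c + g2 (B c) * X c ^ 2 + g3 (B c) * X c ^ 3).
  assert (EP : sumR (bvecs k) (fun c => nu k D0 c * P c) = sumR (bvecs k) (fun c => nu k D1 c * P c)).
  { assert (Q : forall f m, (m <= 3)%nat ->
      sumR (bvecs k) (fun c => nu k D0 c * (f (B c) * X c ^ m))
      = sumR (bvecs k) (fun c => nu k D1 c * (f (B c) * X c ^ m))).
    { intros f m Hm.
      (* [B c] takes only the values [s] and [s + a], so [f (B c)] is affine in the bit [i0]; this
         adds one to the degree [m <= 3]. *)
      assert (Y : forall D, sumR (bvecs k) (fun c => nu k D c * (f (B c) * X c ^ m))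
        = f s * sumR (bvecs k) (fun c => nu k D c * (monomial [] c * X c ^ m))
        + (f (s + a) - f s) * sumR (bvecs k) (fun c => nu k D c * (monomial [i0] c * X c ^ m))).
      { intros D. rewrite <- !sumR_scal, <- sumR_plus. apply sumR_ext; intros c _.
        unfold B, monomial. cbn [fold_right]. destruct (nth i0 c false); simpl.
        - replace (s + a * 1) with (s + a) by ring. ring.
        - replace (s + a * 0) with s by ring. ring. }
      rewrite !Y. unfold X. f_equal; f_equal; apply nu_power_match; simpl; intuition (subst; auto; lia). }
    assert (Z : forall D, sumR (bvecs k) (fun c => nu k D c * P c)
      = sumR (bvecs k) (fun c => nu k D c * (G (B c) * X c ^ 0))
      + sumR (bvecs k) (fun c => nu k D c * (g1 (B c) * X c ^ 1))
      + sumR (bvecs k) (fun c => nu k D c * (g2 (B c) * X c ^ 2))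
      + sumR (bvecs k) (fun c => nu k D c * (g3 (B c) * X c ^ 3))).
    { intros D. rewrite <- !sumR_plus. apply sumR_ext; intros c _. unfold P. ring. }
    rewrite !Z. rewrite !Q by lia. reflexivity. }
  assert (R : forall D, is_distr k D ->
    Rabs (sumR (bvecs k) (fun c => nu k D c * G (s + (a * b2R (nth i0 c false) + X c)))
          - sumR (bvecs k) (fun c => nu k D c * P c)) <= E).
  { intros D HD. rewrite <- sumR_minus.
    rewrite (sumR_ext _ _ (fun c => nu k D c * (G (B c + X c) - P c))).
    - apply sumR_law_abs_le; [now apply nu_law|]. intros c Hc. now apply HT.
    - intros c _. unfold B, X. rewrite Rplus_assoc. ring. }
  assert (R0 := R D0 HD0). assert (R1 := R D1 HD1). rewrite EP in R0.
  apply Rabs_le_between in R0, R1. apply Rabs_le_between. lra.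
Qed.

(** * The smoothed threshold *)

Definition pos4 (x : R) : R := (Rmax 0 x)^4.

(** Division by [4!] makes the fourth difference of [x^4] equal to 1, hence the value 1 of
    [smooth_step] from 4 on. *)
Definition fourth_diff (f : R -> R) (x : R) : R :=
  (f x - 4 * f (x - 1) + 6 * f (x - 2) - 4 * f (x - 3) + f (x - 4)) / 24.

(* The cumulative distribution function of the sum of four uniform variables on [0,1]:
   a quartic spline, for which Taylor's formula is a polynomial identity. *)
Definition smooth_step : R -> R := fourth_diff pos4.

(** On one side of 0 the remainder is [x^4] or 0. If [a] and [a + x] lie on different sides then
    [Rabs (a + x) <= Rabs x], and the remainder lies between 0 and [x^4]. *)
Lemma pos4_taylor a x :
  Rabs (pos4 (a + x) - (pos4 a + 4 * Rmax 0 a ^ 3 * x + 6 * Rmax 0 a ^ 2 * x^2 + 4 * Rmax 0 a * x^3))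
  <= x^4.
Proof.
  unfold pos4, Rmax. assert (X : 0 <= x^4) by nra.
  destruct (Rle_dec 0 (a + x)) as [P|P], (Rle_dec 0 a) as [Q|Q].
  - replace (_ - _) with (x^4) by ring. rewrite Rabs_right; lra.
  - replace (_ - _) with ((a + x)^4) by ring.
    assert ((a + x)^4 <= x^4) by (apply pow_incr; lra).
    rewrite Rabs_right; [lra|]. apply Rle_ge, pow_le; lra.
  - replace (_ - _) with (x^4 - (- (a + x))^4) by ring.
    assert ((- (a + x))^4 <= (- x)^4) by (apply pow_incr; lra).
    assert (0 <= (- (a + x))^4) by (apply pow_le; lra).
    replace ((- x)^4) with (x^4) in * by ring.
    rewrite Rabs_right; lra.
  - replace (_ - _) with 0 by ring. rewrite Rabs_R0. lra.
Qed.

(** The five remainders enter with total weight [(1 + 4 + 6 + 4 + 1) / 24 < 1]. *)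
Lemma smooth_step_taylor a x :
  Rabs (smooth_step (a + x) - (smooth_step a + fourth_diff (fun y => 4 * Rmax 0 y ^ 3) a * x
    + fourth_diff (fun y => 6 * Rmax 0 y ^ 2) a * x^2 + fourth_diff (fun y => 4 * Rmax 0 y) a * x^3)) <= x^4.
Proof.
  unfold smooth_step, fourth_diff.
  assert (T : forall i, Rabs (pos4 (a + x - i) - (pos4 (a - i) + 4 * Rmax 0 (a - i) ^ 3 * x
     + 6 * Rmax 0 (a - i) ^ 2 * x^2 + 4 * Rmax 0 (a - i) * x^3)) <= x^4).
  { intros i. replace (a + x - i) with (a - i + x) by ring. apply pos4_taylor. }
  assert (T0 := pos4_taylor a x).
  assert (T1 := T 1). assert (T2 := T 2). assert (T3 := T 3). assert (T4 := T 4). clear T.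
  apply Rabs_le_between in T0, T1, T2, T3, T4.
  apply Rabs_le_between. lra.
Qed.

Lemma smooth_step_below x : x <= 0 -> smooth_step x = 0.
Proof. intros H. unfold smooth_step, fourth_diff, pos4. rewrite !Rmax_left by lra. field. Qed.

Lemma smooth_step_above x : 4 <= x -> smooth_step x = 1.
Proof. intros H. unfold smooth_step, fourth_diff, pos4. rewrite !Rmax_right by lra. field. Qed.

(** Bounding the five terms separately is crude, but affects only the absolute constant. *)
Lemma smooth_step_bound x : x <= 4 -> Rabs (smooth_step x) <= 29.
Proof.
  intros H. unfold smooth_step, fourth_diff.
  assert (P : forall i r, 0 <= r -> x - i <= r -> 0 <= pos4 (x - i) <= r^4).
  { intros i r Hr Hx. unfold pos4. split; [apply pow_le, Rmax_l|].
    apply pow_incr. split; [apply Rmax_l|apply Rmax_lub; lra]. }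
  assert (P0 := P 0 4). assert (P1 := P 1 3). assert (P2 := P 2 2). assert (P3 := P 3 1).
  assert (P4 := P 4 0). rewrite Rminus_0_r in P0.
  specialize (P0 ltac:(lra) ltac:(lra)). specialize (P1 ltac:(lra) ltac:(lra)).
  specialize (P2 ltac:(lra) ltac:(lra)). specialize (P3 ltac:(lra) ltac:(lra)).
  specialize (P4 ltac:(lra) ltac:(lra)).
  apply Rabs_le_between. lra.
Qed.

(** * Order by magnitude and the critical index *)

(** Here [j] precedes [i]; with this argument order [before u i] is the predicate counted by
    [rank_in]. *)
Definition before (u : nat -> R) (i j : nat) : bool :=
  if Rlt_dec (Rabs (u i)) (Rabs (u j)) then true
  else if Req_EM_T (Rabs (u j)) (Rabs (u i)) then Nat.ltb j i else false.

Lemma before_irrefl u i : before u i i = false.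
Proof.
  unfold before. destruct (Rlt_dec _ _); [lra|]. destruct (Req_EM_T _ _); [|auto].
  apply Nat.ltb_irrefl.
Qed.

Lemma before_trans u a b c : before u b a = true -> before u c b = true -> before u c a = true.
Proof.
  unfold before.
  destruct (Rlt_dec (Rabs (u b)) (Rabs (u a))), (Req_EM_T (Rabs (u a)) (Rabs (u b))),
    (Rlt_dec (Rabs (u c)) (Rabs (u b))), (Req_EM_T (Rabs (u b)) (Rabs (u c))),
    (Rlt_dec (Rabs (u c)) (Rabs (u a))), (Req_EM_T (Rabs (u a)) (Rabs (u c)));
    try easy; try lra. rewrite !Nat.ltb_lt. lia.
Qed.

Lemma before_total u a b : a <> b -> before u a b = true \/ before u b a = true.
Proof.
  intros H. unfold before.
  destruct (Rlt_dec (Rabs (u b)) (Rabs (u a))), (Req_EM_T (Rabs (u a)) (Rabs (u b))),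
    (Rlt_dec (Rabs (u a)) (Rabs (u b))), (Req_EM_T (Rabs (u b)) (Rabs (u a)));
    auto; try lra. rewrite !Nat.ltb_lt. lia.
Qed.

Lemma filter_length_lt {A} (f g : A -> bool) l a :
  (forall x, f x = true -> g x = true) -> In a l -> f a = false -> g a = true ->
  (length (filter f l) < length (filter g l))%nat.
Proof.
  intros H. assert (W : forall l, (length (filter f l) <= length (filter g l))%nat).
  { clear l. induction l as [|x l IH]; simpl; [lia|]. specialize (H x).
    destruct (f x), (g x); simpl; try lia; now specialize (H eq_refl). }
  induction l as [|x l IH]; intros Ha Hf Hg; [easy|]. simpl. destruct Ha as [->|Ha].
  - rewrite Hf, Hg. simpl. specialize (W l). lia.
  - specialize (IH Ha Hf Hg). specialize (H x).
    destruct (f x), (g x); simpl; try lia; now specialize (H eq_refl).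
Qed.

Lemma rank_lt n u i : (i < n)%nat -> (rank_in n u i < n)%nat.
Proof.
  intros Hi. unfold rank_in. fold (before u i).
  apply Nat.lt_le_trans with (length (filter (fun _ => true) (seq 0 n))).
  - apply filter_length_lt with i; auto; [apply in_seq; lia|apply before_irrefl].
  - rewrite <- (length_seq n 0) at 2. apply filter_length_le.
Qed.

(** By transitivity the predecessors of [a] are predecessors of [b], and [a] itself is one more. *)
Lemma rank_before n u a b : (a < n)%nat -> before u b a = true ->
  (rank_in n u a < rank_in n u b)%nat.
Proof.
  intros Ha H. unfold rank_in. fold (before u a) (before u b).
  apply filter_length_lt with a; auto.
  - intros x Hx. now apply before_trans with a.
  - apply in_seq; lia.
  - apply before_irrefl.
Qed.

Lemma rank_inj n u a b : (a < n)%nat -> (b < n)%nat ->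
  rank_in n u a = rank_in n u b -> a = b.
Proof.
  intros Ha Hb E. destruct (Nat.eq_dec a b) as [|N]; auto. exfalso.
  destruct (before_total u a b N) as [H|H]; apply (rank_before n) in H; auto; lia.
Qed.

(** Ranks are an injective map of an [n]-element set to itself, hence onto. *)
Lemma rank_surj n u l : (l < n)%nat -> exists j, (j < n)%nat /\ rank_in n u j = l.
Proof.
  intros Hl.
  assert (I : incl (seq 0 n) (map (rank_in n u) (seq 0 n))).
  { apply NoDup_length_incl.
    - apply NoDup_map_NoDup_ForallPairs; [|apply seq_NoDup].
      intros a b Ha Hb. apply in_seq in Ha, Hb. apply rank_inj; lia.
    - rewrite length_map. lia.
    - intros r Hr. apply in_map_iff in Hr as [j [<- Hj]]. apply in_seq in Hj.
      apply in_seq. assert (R := rank_lt n u j). lia. }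
  assert (H : In l (map (rank_in n u) (seq 0 n))) by (apply I, in_seq; lia).
  apply in_map_iff in H as [j [E Hj]]. apply in_seq in Hj. exists j. split; [lia|auto].
Qed.

Lemma rank_le_abs n u a b : (b < n)%nat -> (rank_in n u a <= rank_in n u b)%nat ->
  Rabs (u b) <= Rabs (u a).
Proof.
  intros Hb H. destruct (Rle_dec (Rabs (u b)) (Rabs (u a))) as [|N]; auto. exfalso.
  assert (L := rank_before n u b a Hb). unfold before in L.
  destruct (Rlt_dec (Rabs (u a)) (Rabs (u b))); [|lra]. specialize (L eq_refl). lia.
Qed.

(** * Tail mass and its decay *)

Definition tailsq (n : nat) (u : nat -> R) (l : nat) : R :=
  sumR (seq 0 n) (fun j => if Nat.ltb (rank_in n u j) l then 0 else u j ^ 2).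

Lemma tailsq_nonneg n u l : 0 <= tailsq n u l.
Proof. apply sumR_nonneg. intros j _. destruct (Nat.ltb _ _); [lra|apply pow2_ge_0]. Qed.

Lemma tailsq_S n u j : (j < n)%nat ->
  tailsq n u (S (rank_in n u j)) + u j ^ 2 <= tailsq n u (rank_in n u j).
Proof.
  intros Hj. set (l := rank_in n u j).
  set (f := fun i => if Nat.eqb (rank_in n u i) l then u i ^ 2 else 0).
  assert (E : tailsq n u l = tailsq n u (S l) + sumR (seq 0 n) f).
  { unfold tailsq. rewrite <- sumR_plus. apply sumR_ext. intros i _. unfold f.
    destruct (Nat.ltb_spec (rank_in n u i) l), (Nat.ltb_spec (rank_in n u i) (S l)),
      (Nat.eqb_spec (rank_in n u i) l); try lia; lra. }
  assert (L : f j <= sumR (seq 0 n) f).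
  { apply sumR_term_le; [|apply in_seq; lia]. intros i _. unfold f.
    destruct (Nat.eqb _ _); [apply pow2_ge_0|lra]. }
  assert (f j = u j ^ 2) by (unfold f, l; now rewrite Nat.eqb_refl). lra.
Qed.

(** Iterates [1 - x <= exp (- x)]. The range stops at [N] because the critical-index argument knows
    the contraction only up to the head length. *)
Lemma geometric_decay (q : nat -> R) x N : 0 <= x <= 1 -> (forall l, 0 <= q l) ->
  (forall l, (l <= N)%nat -> q (S l) <= (1 - x) * q l) ->
  forall l d, (l + d <= N)%nat -> q (l + d)%nat <= exp (- (x * INR d)) * q l.
Proof.
  intros Hx Hq H l. induction d as [|d IH]; intros Hd.
  - rewrite Nat.add_0_r. simpl. rewrite Rmult_0_r, Ropp_0, exp_0. lra.
  - rewrite S_INR. replace (- (x * (INR d + 1))) with (- x + - (x * INR d)) by ring.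
    rewrite exp_plus, Rmult_assoc, Nat.add_succ_r.
    eapply Rle_trans; [apply H; lia|].
    apply Rmult_le_compat; [lra|apply Hq| |apply IH; lia].
    assert (E := exp_ineq1_le (- x)). lra.
Qed.

Lemma Rabs_le_of_sqr a b c : 0 <= c -> a ^ 2 <= c ^ 2 * b ^ 2 -> Rabs a <= c * Rabs b.
Proof.
  intros Hc H. apply Rsqr_incr_0_var.
  - unfold Rsqr. rewrite <- (pow2_abs a), <- (pow2_abs b) in H. nra.
  - apply Rmult_le_pos; [auto|apply Rabs_pos].
Qed.

Lemma tau_bounds k : (2 <= k)%nat -> 0 < tau k <= / 128 /\ 4 * INR k ^ 2 * tau k <= / 8.
Proof.
  intros Hk. assert (K : 2 <= INR k) by (apply (le_INR 2); auto). unfold tau.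
  assert (P5 : 2 ^ 5 <= INR k ^ 5) by (apply pow_incr; lra).
  assert (P7 : 2 ^ 7 <= INR k ^ 7) by (apply pow_incr; lra).
  split; [split|].
  - apply Rinv_0_lt_compat. lra.
  - apply Rinv_le_contravar; lra.
  - replace (4 * INR k ^ 2 * / INR k ^ 7) with (4 * / INR k ^ 5) by (field; lra).
    assert (/ INR k ^ 5 <= / 32) by (apply Rinv_le_contravar; lra). lra.
Qed.

Lemma ceil_nat x : 0 < x ->
  exists m : nat, IZR (Zceil x) = INR (S m) /\ x <= INR (S m).
Proof.
  intros Hx. assert (B := Zceil_bound x).
  assert (0 < Zceil x)%Z by (apply lt_IZR; lra).
  exists (Z.to_nat (Zceil x - 1)).
  replace (S (Z.to_nat (Zceil x - 1))) with (Z.to_nat (Zceil x)) by lia.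
  rewrite INR_IZR_INZ, Z2Nat.id by lia. lra.
Qed.

(* The critical-index dichotomy: [hd] marks the head of the row and [v] is the row, whose
   tail has been deleted when the weights decay geometrically. *)
Lemma row_structure k n u : (2 <= k)%nat -> (1 <= n)%nat -> exists (hd : nat -> bool) (v : nat -> R),
  (forall j, (j < n)%nat -> hd j = true -> inB (t_param k n) n u j) /\
  (forall j, (j < n)%nat -> hd j = false ->
     v j ^ 2 <= tau k ^ 2 * sumR (seq 0 n) (fun i => if hd i then 0 else v i ^ 2)) /\
  ((forall j, (j < n)%nat -> v j = u j) \/
   exists l, NoDup l /\ (forall j, In j l -> (j < n)%nat) /\
     4 * INR k ^ 2 * ln (INR k) <= INR (length l) /\
     separated (2 * INR k * sumR (seq 0 n) (fun j => Rabs (u j - v j))) (map v l)).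
Proof.
  intros Hk Hn.
  assert (K : 2 <= INR k) by (apply (le_INR 2); auto).
  assert (N1 : 1 <= INR n) by (apply (le_INR 1); auto).
  destruct (tau_bounds k Hk) as [T1 T2].
  set (ta := tau k) in *. set (t := t_param k n).
  set (r := rank_in n u).
  (* Either some prefix of at most [t] weights leaves a regular tail and becomes the head, or every
     such prefix leaves an irregular one. *)
  destruct (classic (exists l, INR l <= t /\ forall j, (j < n)%nat -> (l <= r j)%nat ->
                       u j ^ 2 <= ta ^ 2 * tailsq n u l)) as [[l [Hl Hreg]]|Hirr].
  - exists (fun j => Nat.ltb (r j) l), u. split; [|split].
    + intros j Hj Hh. apply Nat.ltb_lt in Hh. split; [auto|].
      fold r. rewrite <- S_INR.
      eapply Rle_trans; [apply le_INR; exact Hh|auto].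
    + intros j Hj Hh. apply Nat.ltb_ge in Hh. now apply Hreg.
    + left; auto.
  - assert (Step : forall l, INR l <= t -> exists j, (j < n)%nat /\ r j = l /\
              ta ^ 2 * tailsq n u l < u j ^ 2).
    { intros l Hl.
      assert (E : exists j, (j < n)%nat /\ (l <= r j)%nat /\ ta ^ 2 * tailsq n u l < u j ^ 2).
      { apply NNPP. intros Nex. apply Hirr. exists l. split; auto. intros j Hj Hr.
        destruct (Rle_dec (u j ^ 2) (ta ^ 2 * tailsq n u l)); auto. exfalso.
        apply Nex. exists j. repeat split; auto. lra. }
      destruct E as [j [Hj [Hr Hu]]].
      assert (Hrn := rank_lt n u j Hj). fold r in Hrn.
      destruct (rank_surj n u l) as [j' [Hj' Er]]; [unfold r in *; lia|].
      exists j'. repeat split; auto. eapply Rlt_le_trans; [exact Hu|].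
      assert (A : Rabs (u j) <= Rabs (u j')) by (apply rank_le_abs with n; auto; unfold r in *; lia).
      rewrite <- (pow2_abs (u j)), <- (pow2_abs (u j')). apply pow_incr.
      split; [apply Rabs_pos|auto]. }
    assert (Lt : 0 < ln (1 / ta)).
    { rewrite <- ln_1. apply ln_increasing; [lra|]. apply Rmult_lt_reg_r with ta; [lra|].
      unfold Rdiv. rewrite Rmult_assoc, Rinv_l; lra. }
    assert (Lk : 0 < ln (INR k)) by (rewrite <- ln_1; apply ln_increasing; lra).
    assert (Ln : 0 <= ln (INR n)).
    { destruct (Rle_lt_or_eq_dec _ _ N1) as [L|L];
        [left; rewrite <- ln_1; apply ln_increasing; lra|rewrite <- L, ln_1; lra]. }
    assert (Ita : 0 < 1 / ta ^ 2) by (apply Rdiv_lt_0_compat; [lra|nra]).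
    destruct (ceil_nat (4 * INR k ^ 2 * ln (INR k))) as [M [EM HM]].
    { apply Rmult_lt_0_compat; [nra|auto]. }
    destruct (ceil_nat (4 / ta ^ 2 * ln (1 / ta))) as [s' [Es Hs]].
    { apply Rmult_lt_0_compat; auto. unfold Rdiv in *. lra. }
    set (s := S s') in *.
    set (Q := 1 / ta ^ 2 * (3 * ln (1 / ta) + ln (INR n))).
    assert (HQ : 0 <= Q) by (apply Rmult_le_pos; lra).
    destruct (nfloor_ex Q HQ) as [q Hq].
    (* The head length: [S M] blocks of [s] ranks, then [q] more, where [q] is [Q] rounded down. It
       fits within [t]. *)
    set (H := (S M * s + q)%nat).
    assert (HH : INR H <= t).
    { unfold t, t_param. fold ta. rewrite EM, Es. fold s. fold Q.
      unfold H. rewrite plus_INR, mult_INR. lra. }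
    assert (Step' : forall l, (l < S H)%nat -> exists j, (j < n)%nat /\ r j = l /\
              ta ^ 2 * tailsq n u l < u j ^ 2).
    { intros l Hl. apply Step. eapply Rle_trans; [apply le_INR|exact HH]. lia. }
    destruct (finite_choice _ O _ Step') as [J HJ].
    (* At every rank the removed weight carries more than a fraction [ta^2] of the tail mass. *)
    assert (Decay : forall l d, (l + d <= H)%nat ->
              tailsq n u (l + d) <= exp (- (ta ^ 2 * INR d)) * tailsq n u l).
    { apply geometric_decay; [nra|apply tailsq_nonneg|]. intros l Hl.
      destruct (HJ l) as [Hj [Er Hu]]; [lia|].
      assert (A := tailsq_S n u (J l) Hj). fold (r (J l)) in A. rewrite Er in A. lra. }
    assert (Sq : forall l, (l <= H)%nat -> u (J l) ^ 2 <= tailsq n u l).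
    { intros l Hl. destruct (HJ l) as [Hj [Er Hu]]; [lia|].
      assert (A := tailsq_S n u (J l) Hj). fold (r (J l)) in A. rewrite Er in A.
      assert (B := tailsq_nonneg n u (S l)). lra. }
    assert (Elog : forall x, exp (- (ta ^ 2 * (1 / ta ^ 2 * x))) = exp (- x)).
    { intros x. f_equal. field. lra. }
    assert (Eln : exp (- ln (1 / ta)) = ta).
    { rewrite exp_Ropp, exp_ln by (apply Rdiv_lt_0_compat; lra). field. lra. }
    assert (Emono : forall d x, 1 / ta ^ 2 * x <= INR d -> exp (- (ta ^ 2 * INR d)) <= exp (- x)).
    { intros d x Hd. rewrite <- (Elog x).
      assert (C : - (ta ^ 2 * INR d) <= - (ta ^ 2 * (1 / ta ^ 2 * x))).
      { apply Ropp_le_contravar, Rmult_le_compat_l; [nra|auto]. }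
      destruct (Rle_lt_or_eq_dec _ _ C) as [C'|C'];
        [left; now apply exp_increasing|right; now rewrite C']. }
    assert (Es4 : exp (- (ta ^ 2 * INR s)) <= ta ^ 4).
    { eapply Rle_trans; [apply (Emono s (4 * ln (1 / ta)))|].
      - unfold Rdiv in *. lra.
      - replace (- (4 * ln (1 / ta)))
          with (- ln (1 / ta) + (- ln (1 / ta) + (- ln (1 / ta) + - ln (1 / ta)))) by ring.
        rewrite !exp_plus, Eln. right; ring. }
    (* The last block has [s >= 1] ranks, which makes up for rounding [Q] down to [q]. *)
    assert (Esq : exp (- (ta ^ 2 * INR (s + q))) <= ta ^ 3 / INR n).
    { eapply Rle_trans; [apply (Emono (s + q)%nat (3 * ln (1 / ta) + ln (INR n)))|].
      - fold Q. rewrite plus_INR. unfold s. rewrite S_INR. assert (P := pos_INR s'). lra.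
      - replace (- (3 * ln (1 / ta) + ln (INR n)))
          with (- ln (1 / ta) + (- ln (1 / ta) + (- ln (1 / ta) + - ln (INR n)))) by ring.
        rewrite !exp_plus, Eln, exp_Ropp, exp_ln by lra. right; field. lra. }
    set (hd := fun j => Nat.ltb (r j) H).
    set (v := fun j => if hd j then u j else 0).
    set (eta := sumR (seq 0 n) (fun j => Rabs (u j - v j))).
    (* Passing from squares to absolute values costs a factor [n], which the term [ln (INR n)] of
       [t] pays for. *)
    assert (Heta : eta ^ 2 <= INR n * tailsq n u H).
    { unfold eta. eapply Rle_trans; [apply sumR_sqr_le|].
      rewrite length_seq. apply Rmult_le_compat_l; [lra|].
      apply sumR_le. intros j _. rewrite pow2_abs. unfold v, hd, r.
      destruct (Nat.ltb _ _); [right; ring|rewrite Rminus_0_r; lra]. }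
    assert (BM : forall l, (l <= M)%nat -> (l * s < H)%nat) by (intros l Hl; unfold H, s; nia).
    assert (VJ : forall l, (l <= M)%nat -> v (J (l * s)%nat) = u (J (l * s)%nat)).
    { intros l Hl. assert (B := BM l Hl). destruct (HJ (l * s)%nat) as [_ [Er _]]; [lia|].
      unfold v, hd. rewrite Er. apply Nat.ltb_lt in B. now rewrite B. }
    exists hd, v. split; [|split].
    + intros j Hj Hh. unfold hd in Hh. apply Nat.ltb_lt in Hh. split; [auto|].
      fold r. rewrite <- S_INR.
      eapply Rle_trans; [apply le_INR; exact Hh|auto].
    + intros j Hj Hh. unfold v at 1. rewrite Hh.
      assert (0 <= sumR (seq 0 n) (fun i => if hd i then 0 else v i ^ 2)).
      { apply sumR_nonneg. intros i _. destruct (hd i); [lra|apply pow2_ge_0]. }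
      nra.
    (* One weight from each block: the ranks 0, [s], ..., [M * s], all inside the head. *)
    + right. exists (map (fun l => J (l * s)%nat) (seq 0 (S M))). split; [|split; [|split]].
      * apply NoDup_map_NoDup_ForallPairs; [|apply seq_NoDup].
        intros a b Ha Hb E. apply in_seq in Ha, Hb.
        destruct (HJ (a * s)%nat) as [_ [Ea _]]; [specialize (BM a); lia|].
        destruct (HJ (b * s)%nat) as [_ [Eb _]]; [specialize (BM b); lia|].
        assert (a * s = b * s)%nat by congruence. unfold s in *. nia.
      * intros j Hj. apply in_map_iff in Hj as [l [<- Hl]]. apply in_seq in Hl.
        apply HJ. specialize (BM l). lia.
      * rewrite length_map, length_seq. auto.
      * rewrite map_map. fold eta. apply (separated_geometric (fun l => v (J (l * s)%nat))).
        (* A block shrinks the tail mass by [ta^4]. Irregularity costs back [ta^2], so successive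
           squares have ratio at most [ta^2 <= 1/16]. *)
        -- intros l _ Hl. rewrite !VJ by lia.
           destruct (HJ (l * s)%nat) as [_ [_ Hu]]; [specialize (BM l); lia|].
           assert (A1 := Sq (S l * s)%nat). specialize (A1 ltac:(specialize (BM (S l)); lia)).
           assert (A2 := Decay (l * s)%nat s). replace (l * s + s)%nat with (S l * s)%nat in A2 by lia.
           specialize (A2 ltac:(specialize (BM (S l)); lia)).
           assert (A3 := tailsq_nonneg n u (l * s)%nat).
           replace (Rabs (u (J (l * s)%nat)) / 4) with (/ 4 * Rabs (u (J (l * s)%nat))) by field.
           apply Rabs_le_of_sqr; [lra|].
           set (X := tailsq n u (l * s)) in *.
           assert (A4 : exp (- (ta ^ 2 * INR s)) * X <= ta ^ 4 * X) by (apply Rmult_le_compat_r; auto).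
           assert (A5 : ta ^ 4 * X <= ta ^ 2 * u (J (l * s)%nat) ^ 2).
           { replace (ta ^ 4 * X) with (ta ^ 2 * (ta ^ 2 * X)) by ring.
             apply Rmult_le_compat_l; [nra|lra]. }
           assert (A6 : ta ^ 2 * u (J (l * s)%nat) ^ 2 <= (/ 4) ^ 2 * u (J (l * s)%nat) ^ 2).
           { apply Rmult_le_compat_r; [apply pow2_ge_0|nra]. }
           lra.
        (* From the last chosen rank to [H] the tail mass falls by [ta^3 / n], so
           [eta^2 <= ta * y^2], and [4 k^2 ta] is below [1/4]. *)
        -- rewrite Nat.add_0_l, VJ by lia.
           destruct (HJ (M * s)%nat) as [_ [_ Hu]]; [specialize (BM M); lia|].
           assert (A2 := Decay (M * s)%nat (s + q)%nat).
           replace (M * s + (s + q))%nat with H in A2 by (unfold H; lia).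
           specialize (A2 (le_n _)).
           assert (A3 := tailsq_nonneg n u (M * s)%nat).
           set (X := tailsq n u (M * s)) in *. set (y := u (J (M * s)%nat)) in *.
           assert (E0 : 0 <= eta) by (apply sumR_nonneg; intros; apply Rabs_pos).
           assert (A4 : exp (- (ta ^ 2 * INR (s + q))) * X <= ta ^ 3 / INR n * X)
             by (apply Rmult_le_compat_r; auto).
           assert (A5 : eta ^ 2 <= ta * (ta ^ 2 * X)).
           { eapply Rle_trans; [exact Heta|].
             apply Rle_trans with (INR n * (ta ^ 3 / INR n * X)).
             - apply Rmult_le_compat_l; lra.
             - right. field. lra. }
           assert (A6 : eta ^ 2 <= ta * y ^ 2).
           { eapply Rle_trans; [exact A5|]. apply Rmult_le_compat_l; lra. }
           replace (Rabs y / 2) with (/ 2 * Rabs y) by field.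
           rewrite <- (Rabs_right (2 * INR k * eta)) by (apply Rle_ge, Rmult_le_pos; lra).
           apply Rabs_le_of_sqr; [lra|].
           replace ((2 * INR k * eta) ^ 2) with (4 * INR k ^ 2 * eta ^ 2) by ring.
           apply Rle_trans with (4 * INR k ^ 2 * (ta * y ^ 2)).
           ++ apply Rmult_le_compat_l; [nra|auto].
           ++ rewrite <- Rmult_assoc. apply Rmult_le_compat_r; [apply pow2_ge_0|lra].
        (* Irregularity is a strict inequality, so the chosen weight is nonzero. *)
        -- rewrite Nat.add_0_l, VJ by lia.
           destruct (HJ (M * s)%nat) as [_ [_ Hu]]; [specialize (BM M); lia|].
           assert (A3 := tailsq_nonneg n u (M * s)%nat).
           apply Rabs_pos_lt. intros E. rewrite E in Hu.
           assert (0 <= ta ^ 2 * tailsq n u (M * s)) by (apply Rmult_le_pos; [nra|auto]). lra.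
Qed.

(** * The test distribution *)

Definition score (k n : nat) (w : nat -> nat -> R) (y : list (list bool)) : R :=
  sumR (seq 0 n) (fun j => colsum k (fun i => w i j) (nth j y [])).

Definition step (theta s : R) : R := if Rle_dec theta s then 1 else 0.

Definition testE (k n : nat) (D : list bool -> R) (F : list (list bool) -> R) : R :=
  sumR (lists_of (bvecs k) n) (fun y => test_prob k n D y * F y).

Lemma halfspace_step k n w theta y :
  (if halfspace k n w theta y then 1 else 0) = step theta (score k n w y).
Proof.
  unfold halfspace, step, score, colsum, entry. rewrite sumR_swap.
  set (s := sumR (seq 0 n) _).
  destruct (Rle_dec 0 (s - theta)), (Rle_dec theta s); lra.
Qed.

Lemma test_prob_noisy k n D y : test_prob k n D y
  = sumR (lists_of (bvecs k) n) (fun x => prodR (seq 0 n) (fun j => D (nth j x []))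
      * prodR (seq 0 n) (fun j => noisy k (nth j x []) (nth j y []))).
Proof.
  apply sumR_ext; intros x Hx. f_equal.
  apply in_lists_of in Hx as [Hl _]. fold (prodR x D). rewrite (prodR_nth D [] x), Hl. reflexivity.
Qed.

(** Distributivity turns the sum over all matrices [x] into a product over columns: the noisy
    columns are independent with law [nu k D]. *)
Lemma test_prob_nu k n D y :
  test_prob k n D y = prodR (seq 0 n) (fun j => nu k D (nth j y [])).
Proof.
  rewrite test_prob_noisy. unfold nu.
  rewrite <- (sumR_prodR_lists_of (bvecs k) n (fun j x => D x * noisy k x (nth j y []))).
  apply sumR_ext; intros x _. now rewrite prodR_mult.
Qed.

Lemma testE_colE k n D w G :
  testE k n D (fun y => G (score k n w y))
  = colE (bvecs k) n (fun _ => nu k D) (fun j c => colsum k (fun i => w i j) c) G.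
Proof.
  rewrite <- sumR_lists_of_colE. apply sumR_ext; intros y _. now rewrite test_prob_nu.
Qed.

Lemma test_prob_nonneg k n D y : (2 <= k)%nat -> is_distr k D ->
  In y (lists_of (bvecs k) n) -> 0 <= test_prob k n D y.
Proof.
  intros Hk HD Hy. rewrite test_prob_nu. apply in_lists_of in Hy as [Hl Hy].
  apply prodR_nonneg. intros j Hj. apply (nu_law k D Hk HD). apply Hy, nth_In.
  apply in_seq in Hj. lia.
Qed.

Lemma test_prob_sum k n D : (2 <= k)%nat -> is_distr k D ->
  sumR (lists_of (bvecs k) n) (test_prob k n D) = 1.
Proof.
  intros Hk HD.
  rewrite (sumR_ext _ _ (fun y => prodR (seq 0 n) (fun j => nu k D (nth j y []))))
    by (intros; apply test_prob_nu).
  rewrite (sumR_prodR_lists_of (bvecs k) n (fun _ => nu k D)).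
  apply prodR_one. intros. apply (nu_law k D Hk HD).
Qed.

Lemma testE_diff_le k n D F F' B : (2 <= k)%nat -> is_distr k D ->
  (forall y, Rabs (F y - F' y) <= B y) -> Rabs (testE k n D F - testE k n D F') <= testE k n D B.
Proof.
  intros Hk HD H. unfold testE. rewrite <- sumR_minus.
  eapply Rle_trans; [apply sumR_abs|]. apply sumR_le. intros y Hy.
  rewrite <- Rmult_minus_distr_l, Rabs_mult.
  assert (P := test_prob_nonneg k n D y Hk HD Hy).
  rewrite (Rabs_right (test_prob _ _ _ _)) by lra. apply Rmult_le_compat_l; auto.
Qed.

Lemma testE_scal k n D c F : testE k n D (fun y => c * F y) = c * testE k n D F.
Proof. unfold testE. rewrite <- sumR_scal. apply sumR_ext; intros; ring. Qed.

(** * Reduction to independent bits *)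

Lemma bvecs_bitE k : forall (g : nat -> bool -> R) u G, (forall i, g i false + g i true = 1) ->
  sumR (bvecs k) (fun c => prodR (seq 0 k) (fun i => g i (nth i c false)) * G (colsum k u c))
  = bitE (map (fun i => (u i, g i true)) (seq 0 k)) G.
Proof.
  induction k as [|k IH]; intros g u G Hg.
  - unfold prodR, colsum. simpl. lra.
  - replace (map (fun i => (u i, g i true)) (seq 0 (S k)))
      with ((u O, g O true) :: map (fun i => (u (S i), g (S i) true)) (seq 0 k))
      by (cbn [seq map]; now rewrite <- seq_shift, map_map).
    cbn [bitE].
    rewrite <- (IH (fun i => g (S i)) (fun i => u (S i)) G) by auto.
    rewrite <- (IH (fun i => g (S i)) (fun i => u (S i)) (fun s => G (u O + s))) by auto.
    rewrite sumR_bvecs_S, <- !sumR_scal, <- sumR_plus. apply sumR_ext; intros c _.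
    unfold colsum. rewrite !prodR_seq_S, !sumR_seq_S. cbn [nth b2R].
    replace (1 - g O true) with (g O false) by (specialize (Hg O); lra).
    rewrite Rmult_0_r, Rplus_0_l, Rmult_1_r. ring.
Qed.

(** Column by column, so that the recursion of [colE] peels off an initial segment. *)
Definition cells (k n : nat) : list (nat * nat) :=
  flat_map (fun j => map (fun i => (i, j)) (seq 0 k)) (seq 0 n).

Lemma in_cells k n i j : In (i, j) (cells k n) <-> (i < k)%nat /\ (j < n)%nat.
Proof.
  unfold cells. rewrite in_flat_map. split.
  - intros [j' [Hj' H]]. apply in_map_iff in H as [i' [E Hi']]. inversion E; subst.
    apply in_seq in Hj', Hi'. lia.
  - intros [Hi Hj]. exists j. split; [apply in_seq; lia|].
    apply in_map_iff. exists i. split; [auto|apply in_seq; lia].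
Qed.

Definition bits (k : nat) (w : nat -> nat -> R) (x : list (list bool)) (l : list (nat * nat)) :
  list (R * R) :=
  map (fun ij => (w (fst ij) (snd ij), noise k (entry x (fst ij) (snd ij)) true)) l.

Lemma colE_bitE k n : forall (g : nat -> nat -> bool -> R) w G,
  (forall i j, g i j false + g i j true = 1) ->
  colE (bvecs k) n (fun j c => prodR (seq 0 k) (fun i => g i j (nth i c false)))
    (fun j c => colsum k (fun i => w i j) c) G
  = bitE (map (fun ij => (w (fst ij) (snd ij), g (fst ij) (snd ij) true)) (cells k n)) G.
Proof.
  induction n as [|n IH]; intros g w G Hg; [reflexivity|]. cbn [colE].
  set (w' := fun i j => w i (S j)). set (g' := fun i j => g i (S j)).
  assert (E : map (fun ij => (w (fst ij) (snd ij), g (fst ij) (snd ij) true)) (cells k (S n))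
    = map (fun i => (w i O, g i O true)) (seq 0 k)
      ++ map (fun ij => (w' (fst ij) (snd ij), g' (fst ij) (snd ij) true)) (cells k n)).
  { unfold cells. cbn [seq flat_map]. rewrite map_app, map_map. cbn [fst snd]. f_equal.
    rewrite <- seq_shift, !flat_map_concat_map, !map_map, !concat_map, !map_map.
    f_equal. apply map_ext. intros j. now rewrite !map_map. }
  rewrite E, bitE_app, <- (bvecs_bitE k (fun i => g i O) (fun i => w i O)) by auto.
  apply sumR_ext; intros c _. f_equal.
  apply (IH g' w' (fun s => G (colsum k (fun i => w i O) c + s))). unfold g'. auto.
Qed.

(* Conditionally on the unperturbed matrix x the entries of y are independent bits. *)
Lemma testE_le_bits k n D w G M : is_distr k D ->
  (forall x, bitE (bits k w x (cells k n)) G <= M) ->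
  testE k n D (fun y => G (score k n w y)) <= M.
Proof.
  intros [D0 D1] H. unfold testE.
  set (P := fun x : list (list bool) => prodR (seq 0 n) (fun j => D (nth j x []))).
  apply Rle_trans with (sumR (lists_of (bvecs k) n) (fun x => P x * bitE (bits k w x (cells k n)) G)).
  - right. transitivity (sumR (lists_of (bvecs k) n) (fun y => sumR (lists_of (bvecs k) n) (fun x =>
      P x * (prodR (seq 0 n) (fun j => noisy k (nth j x []) (nth j y [])) * G (score k n w y))))).
    + apply sumR_ext; intros y _. rewrite test_prob_noisy, <- sumR_scal_r.
      apply sumR_ext; intros; unfold P; ring.
    + rewrite sumR_swap. apply sumR_ext; intros x _. rewrite sumR_scal. f_equal.
      unfold bits. rewrite <- (colE_bitE k n (fun i j b => noise k (entry x i j) b) w G)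
        by (intros; apply noise_sum).
      rewrite <- sumR_lists_of_colE. apply sumR_ext; intros y _. reflexivity.
  - apply Rle_trans with (sumR (lists_of (bvecs k) n) (fun x => P x * M)).
    + apply sumR_le. intros x Hx. apply Rmult_le_compat_l; auto.
      apply in_lists_of in Hx as [Hl Hx]. apply prodR_nonneg. intros j Hj.
      apply D0, Hx, nth_In. apply in_seq in Hj. lia.
    + rewrite sumR_scal_r. unfold P.
      rewrite (sumR_prodR_lists_of (bvecs k) n (fun _ => D)), prodR_one by auto. lra.
Qed.

Lemma bits_probs k w x l : (2 <= k)%nat -> probs_in (/ (2 * INR k ^ 2)) (bits k w x l).
Proof.
  intros Hk a p H. apply in_map_iff in H as [ij [E _]]. inversion E; subst.
  now apply noise_bounds.
Qed.

Lemma half_noise_bounds k : (2 <= k)%nat -> 0 <= / (2 * INR k ^ 2) <= / 2.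
Proof.
  intros Hk. assert (K : 2 <= INR k) by (apply (le_INR 2); auto).
  split; [left; apply Rinv_0_lt_compat; nra|apply Rinv_le_contravar; nra].
Qed.

Lemma perm_extract {A} (sub l : list A) : NoDup sub -> incl sub l ->
  exists rest, Permutation l (rest ++ sub).
Proof.
  induction sub as [|a sub IH]; intros ND HI.
  - exists l. now rewrite app_nil_r.
  - inversion ND as [|? ? Na Ns]; subst.
    destruct IH as [rest HP]; auto; [intros b Hb; apply HI; now right|].
    assert (Ha : In a (rest ++ sub)) by (apply (Permutation_in _ HP), HI; now left).
    apply in_app_or in Ha as [Ha|Ha]; [|easy].
    apply in_split in Ha as [r1 [r2 ->]]. exists (r1 ++ r2).
    eapply perm_trans; [exact HP|]. rewrite <- !app_assoc. apply Permutation_app_head.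
    simpl. apply Permutation_middle.
Qed.

Lemma pow_one_sub_le_exp x d : 0 <= x <= 1 -> (1 - x) ^ d <= exp (- (x * INR d)).
Proof.
  intros Hx.
  assert (H := geometric_decay (fun l => (1 - x) ^ l) x d Hx
    ltac:(intros; apply pow_le; lra) ltac:(intros; simpl; lra) O d (le_n _)).
  simpl in H. lra.
Qed.

(** * Concentration of the score *)

(** Given [x] and all other noisy bits, the separated bits hit the window of width [2 * r] with
    probability at most [(1 - 1/(2k^2))^(4 k^2 ln k) <= k^-2]; the weaker bound [1/k] is enough. *)
Lemma separated_row_concentration k n D w i l theta r :
  (2 <= k)%nat -> is_distr k D -> (i < k)%nat ->
  NoDup l -> (forall j, In j l -> (j < n)%nat) ->
  4 * INR k ^ 2 * ln (INR k) <= INR (length l) ->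
  separated (2 * r) (map (w i) l) ->
  testE k n D (fun y => near theta r (score k n w y)) <= 1 / INR k.
Proof.
  intros Hk HD Hi ND Hl HL Hs. assert (K : 2 <= INR k) by (apply (le_INR 2); auto).
  assert (Hp := half_noise_bounds k Hk).
  apply testE_le_bits; auto. intros x.
  destruct (perm_extract (map (fun j => (i, j)) l) (cells k n)) as [rest HP].
  { apply NoDup_map_NoDup_ForallPairs; auto. intros a b _ _ E. now inversion E. }
  { intros [i' j] H. apply in_map_iff in H as [j' [E Hj]]. inversion E; subst.
    apply in_cells. auto. }
  set (sub := map (fun j => (i, j)) l) in *.
  apply bitE_sub_le with (/ (2 * INR k ^ 2)) (bits k w x sub) (bits k w x rest);
    [lra|now apply bits_probs|unfold bits; rewrite <- map_app; now apply Permutation_map|].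
  intros c. eapply Rle_trans.
  - apply bitE_separated with (p0 := / (2 * INR k ^ 2)) (eta := 2 * r) (c := theta - r - c);
      [lra|now apply bits_probs| | |].
    + unfold bits, sub. rewrite !map_map. exact Hs.
    + intros s. unfold near. destruct (Rle_dec _ _); lra.
    + intros s. unfold near. destruct (Rle_dec (Rabs (c + s - theta)) r) as [B|B]; [|lra].
      intros _. apply Rabs_le_between in B. lra.
  - unfold bits, sub. rewrite !length_map.
    eapply Rle_trans; [apply pow_one_sub_le_exp; lra|].
    apply Rle_trans with (exp (- ln (INR k))).
    + assert (LK : 0 < ln (INR k)) by (rewrite <- ln_1; apply ln_increasing; lra).
      left. apply exp_increasing.
      assert (/ (2 * INR k ^ 2) * (4 * INR k ^ 2 * ln (INR k)) <= / (2 * INR k ^ 2) * INR (length l))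
        by (apply Rmult_le_compat_l; lra).
      replace (/ (2 * INR k ^ 2) * (4 * INR k ^ 2 * ln (INR k))) with (2 * ln (INR k)) in *
        by (field; lra).
      lra.
    + rewrite exp_Ropp, exp_ln by lra. lra.
Qed.

Lemma truncation_error k n D w v theta : (2 <= k)%nat -> is_distr k D ->
  (forall i, (i < k)%nat -> (forall j, (j < n)%nat -> v i j = w i j) \/
   exists l, NoDup l /\ (forall j, In j l -> (j < n)%nat) /\
     4 * INR k ^ 2 * ln (INR k) <= INR (length l) /\
     separated (2 * INR k * sumR (seq 0 n) (fun j => Rabs (w i j - v i j))) (map (v i) l)) ->
  Rabs (testE k n D (fun y => step theta (score k n w y))
        - testE k n D (fun y => step theta (score k n v y))) <= 1 / INR k.
Proof.
  intros Hk HD HR. assert (K : 2 <= INR k) by (apply (le_INR 2); auto).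
  set (eta := fun i => sumR (seq 0 n) (fun j => Rabs (w i j - v i j))).
  (* All rows together change the score by at most [k] times the largest deleted mass, so the
     separation of that single row covers every deletion. *)
  destruct (exists_argmax eta k) as [i0 [Hi0 Hmax]]; [lia|].
  assert (Hdiff : forall y, Rabs (score k n w y - score k n v y) <= INR k * eta i0).
  { intros y. unfold score. rewrite <- sumR_minus.
    eapply Rle_trans; [apply sumR_abs|].
    apply Rle_trans with (sumR (seq 0 n) (fun j => sumR (seq 0 k) (fun i => Rabs (w i j - v i j)))).
    - apply sumR_le. intros j _. unfold colsum. rewrite <- sumR_minus.
      eapply Rle_trans; [apply sumR_abs|]. apply sumR_le. intros i _.
      rewrite <- Rmult_minus_distr_r, Rabs_mult.
      assert (B : Rabs (b2R (nth i (nth j y []) false)) <= 1).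
      { destruct (nth i (nth j y []) false); simpl; [rewrite Rabs_R1|rewrite Rabs_R0]; lra. }
      assert (P := Rabs_pos (w i j - v i j)). nra.
    - rewrite sumR_swap. apply Rle_trans with (sumR (seq 0 k) (fun _ => eta i0)).
      + apply sumR_le. intros i Hi. apply in_seq in Hi. apply Hmax. lia.
      + rewrite sumR_const, length_seq. lra. }
  destruct (HR i0 Hi0) as [E|[l [ND [Hl [HL Hs]]]]].
  (* If the maximal row is unchanged, every deleted mass is zero and the two scores agree. *)
  - assert (Z : eta i0 = 0).
    { apply sumR_zero. intros j Hj. apply in_seq in Hj. rewrite E by lia.
      rewrite Rminus_diag. apply Rabs_R0. }
    rewrite Z, Rmult_0_r in Hdiff.
    replace (testE k n D (fun y => step theta (score k n w y)))
      with (testE k n D (fun y => step theta (score k n v y))).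
    + rewrite Rminus_diag, Rabs_R0. apply Rdiv_le_0_compat; lra.
    + apply sumR_ext. intros y _. f_equal. f_equal.
      specialize (Hdiff y). assert (P := Rabs_pos (score k n w y - score k n v y)).
      destruct (Req_dec (score k n w y - score k n v y) 0) as [Q|Q]; [lra|].
      apply Rabs_pos_lt in Q. lra.
  - apply Rle_trans with (testE k n D (fun y => near theta (INR k * eta i0) (score k n v y))).
    + apply testE_diff_le; auto. intros y. specialize (Hdiff y).
      apply Rabs_le_between in Hdiff. unfold step, near.
      destruct (Rle_dec (Rabs (score k n v y - theta)) (INR k * eta i0)) as [B|B].
      * destruct (Rle_dec theta (score k n w y)), (Rle_dec theta (score k n v y));
          apply Rabs_le_between; lra.
      * destruct (Rle_dec theta (score k n w y)), (Rle_dec theta (score k n v y));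
          try (rewrite Rminus_diag, Rabs_R0; lra);
          exfalso; apply B, Rabs_le_between; lra.
    + apply separated_row_concentration with i0 l; auto.
      now replace (2 * (INR k * eta i0)) with (2 * INR k * eta i0) by ring.
Qed.

(** Only the tail bits are used; the head bits act as a shift. With [p0 = 1/(2k^2)], window [T/k^2]
    and [beta = k/4] the variance condition of [bitE_concentration] is an equality. *)
Lemma regular_concentration k n D v (hd : nat -> nat -> bool) T c :
  (2 <= k)%nat -> is_distr k D -> 0 < T ->
  sumR (seq 0 n) (fun j => sumR (seq 0 k) (fun i => if hd i j then 0 else v i j ^ 2)) = T ^ 2 ->
  (forall i j, (i < k)%nat -> (j < n)%nat -> hd i j = false -> Rabs (v i j) <= T / INR k ^ 2) ->
  testE k n D (fun y => near c (T / INR k ^ 2) (score k n v y)) <= 32 / INR k.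
Proof.
  intros Hk HD HT HV Hr. assert (K : 2 <= INR k) by (apply (le_INR 2); auto).
  assert (Hp := half_noise_bounds k Hk).
  apply testE_le_bits; auto. intros x.
  set (q := fun ij : nat * nat => negb (hd (fst ij) (snd ij))).
  assert (HP := filter_split_perm q (cells k n)).
  apply bitE_sub_le with (/ (2 * INR k ^ 2)) (bits k v x (filter q (cells k n)))
    (bits k v x (filter (fun a => negb (q a)) (cells k n)));
    [lra|now apply bits_probs|unfold bits; rewrite <- map_app; now apply Permutation_map|].
  intros c'.
  rewrite (bitE_ext _ _ (near (c - c') (T / INR k ^ 2))).
  2:{ intros s. unfold near. now replace (c' + s - c) with (s - (c - c')) by ring. }
  replace (32 / INR k) with (8 / (INR k / 4)) by (field; lra).
  apply bitE_concentration with (/ (2 * INR k ^ 2)); auto; [now apply bits_probs| | | |].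
  - apply Rdiv_lt_0_compat; nra.
  - lra.
  - intros a p H. apply in_map_iff in H as [[i j] [E H]]. inversion E; subst. cbn [fst snd].
    apply filter_In in H as [H Hq]. apply in_cells in H as [Hi Hj].
    apply Hr; auto. unfold q in Hq. simpl in Hq. now destruct (hd i j).
  - right. unfold bits. rewrite sumR_map, sumR_filter. cbn [fst snd].
    transitivity (/ (2 * INR k ^ 2) * T ^ 2); [field; lra|]. f_equal. rewrite <- HV.
    unfold cells. rewrite sumR_flat_map. apply sumR_ext; intros j _. rewrite sumR_map.
    apply sumR_ext; intros i _. unfold q. simpl. destruct (hd i j); reflexivity.
Qed.

Lemma sumR_single {A} (l : list A) f a : NoDup l -> In a l ->
  (forall b, In b l -> b <> a -> f b = 0) -> sumR l f = f a.
Proof.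
  induction l as [|b l IH]; intros ND Ha H; [easy|]. inversion ND as [|? ? Nb Nl]; subst.
  rewrite sumR_cons. destruct Ha as [->|Ha].
  - rewrite sumR_zero; [lra|]. intros b Hb. apply H; [now right|congruence].
  - rewrite H, IH; auto; [lra| |now left|congruence]. intros; apply H; auto. now right.
Qed.

Lemma column_head_split k (hd : nat -> bool) u : (1 <= k)%nat ->
  (forall i i', (i < k)%nat -> (i' < k)%nat -> hd i = true -> hd i' = true -> i = i') ->
  exists i0 a, (i0 < k)%nat /\ forall c,
    colsum k u c = a * b2R (nth i0 c false) + colsum k (fun i => if hd i then 0 else u i) c.
Proof.
  intros Hk H.
  assert (E : forall c, colsum k u c = sumR (seq 0 k)
     (fun i => (if hd i then u i else 0) * b2R (nth i c false))
     + colsum k (fun i => if hd i then 0 else u i) c).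
  { intros c. unfold colsum. rewrite <- sumR_plus. apply sumR_ext. intros i _.
    destruct (hd i); ring. }
  destruct (existsb hd (seq 0 k)) eqn:B.
  - apply existsb_exists in B as [i0 [Hi0 B]]. apply in_seq in Hi0.
    exists i0, (u i0). split; [lia|]. intros c. rewrite E. f_equal.
    rewrite (sumR_single _ _ i0); [now rewrite B|apply seq_NoDup|apply in_seq; lia|].
    intros i Hi Hne. apply in_seq in Hi. destruct (hd i) eqn:B'; [|ring].
    exfalso. apply Hne. apply H; auto; lia.
  (* A column without a head bit gets row 0 with coefficient 0; row 0 exists because [1 <= k]. *)
  - exists O, 0. split; [lia|]. intros c. rewrite E. f_equal. rewrite Rmult_0_l.
    apply sumR_zero. intros i Hi. destruct (hd i) eqn:B'; [|ring].
    assert (X : existsb hd (seq 0 k) = true) by (apply existsb_exists; eauto). congruence.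
Qed.

(** The two functions differ only for scores between [theta] and [theta + 4 * lam], where the
    difference is at most [1 + 29]. *)
Lemma smoothing_error theta lam s : 0 < lam ->
  Rabs (step theta s - smooth_step ((s - theta) / lam)) <= 30 * near (theta + 2 * lam) (2 * lam) s.
Proof.
  intros Hl. set (z := (s - theta) / lam).
  assert (Hs : s = theta + lam * z) by (unfold z; field; lra).
  unfold step, near.
  destruct (Rle_dec (Rabs (s - (theta + 2 * lam))) (2 * lam)) as [B|B].
  - apply Rabs_le_between in B.
    assert (Hz : z <= 4) by nra.
    assert (M := smooth_step_bound z Hz). apply Rabs_le_between in M.
    destruct (Rle_dec theta s); apply Rabs_le_between; lra.
  - assert (D : s < theta \/ theta + 4 * lam < s).
    { destruct (Rlt_dec s theta); [now left|]. right.
      destruct (Rlt_dec (theta + 4 * lam) s); auto. exfalso.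
      apply B, Rabs_le_between. lra. }
    destruct D as [D|D].
    + rewrite smooth_step_below by nra. destruct (Rle_dec theta s); [lra|].
      rewrite Rminus_diag, Rabs_R0. lra.
    + rewrite smooth_step_above by nra. destruct (Rle_dec theta s); [|lra].
      rewrite Rminus_diag, Rabs_R0. lra.
Qed.

(** * Soundness *)

Lemma Rabs_colsum_le k t c : Rabs (colsum k t c) <= sumR (seq 0 k) (fun i => Rabs (t i)).
Proof.
  eapply Rle_trans; [apply sumR_abs|]. apply sumR_le. intros i _.
  rewrite Rabs_mult. assert (P := Rabs_pos (t i)).
  destruct (nth i c false); simpl; [rewrite Rabs_R1|rewrite Rabs_R0]; lra.
Qed.

Lemma column_lindeberg k n D0 D1 v (hd : nat -> nat -> bool) G g1 g2 g3 (e : nat -> R) :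
  (2 <= k)%nat -> is_distr k D0 -> is_distr k D1 -> moments_match4 k D0 D1 ->
  (forall i i' j, (i < k)%nat -> (i' < k)%nat -> (j < n)%nat ->
     hd i j = true -> hd i' j = true -> i = i') ->
  (forall j, (j < n)%nat -> forall b c,
     let x := colsum k (fun i => if hd i j then 0 else v i j) c in
     Rabs (G (b + x) - (G b + g1 b * x + g2 b * x^2 + g3 b * x^3)) <= e j) ->
  Rabs (testE k n D0 (fun y => G (score k n v y)) - testE k n D1 (fun y => G (score k n v y)))
  <= 2 * sumR (seq 0 n) e.
Proof.
  intros Hk HD0 HD1 HM Hd HT. rewrite !testE_colE, <- sumR_scal.
  apply lindeberg; [now apply nu_law|now apply nu_law|].
  intros j s Hj.
  destruct (column_head_split k (fun i => hd i j) (fun i => v i j)) as [i0 [a [Hi0 E]]];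
    [lia|intros; eapply Hd; eauto|].
  assert (X : forall D, sumR (bvecs k) (fun c => nu k D c * G (s + colsum k (fun i => v i j) c))
    = sumR (bvecs k) (fun c => nu k D c * G (s + (a * b2R (nth i0 c false)
        + colsum k (fun i => if hd i j then 0 else v i j) c))))
    by (intros D; apply sumR_ext; intros; now rewrite E).
  rewrite !X.
  apply column_exchange with g1 g2 g3; auto.
Qed.

(** Smoothing costs [960 / k] for each distribution and the exchange of columns [32 / k]. *)
Lemma regular_soundness k n D0 D1 v (hd : nat -> nat -> bool) theta :
  (2 <= k)%nat -> is_distr k D0 -> is_distr k D1 -> moments_match4 k D0 D1 ->
  (forall i i' j, (i < k)%nat -> (i' < k)%nat -> (j < n)%nat ->
     hd i j = true -> hd i' j = true -> i = i') ->
  (forall i j, (i < k)%nat -> (j < n)%nat -> hd i j = false ->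
     v i j ^ 2 <= tau k ^ 2 * sumR (seq 0 n) (fun j => if hd i j then 0 else v i j ^ 2)) ->
  Rabs (testE k n D0 (fun y => step theta (score k n v y))
        - testE k n D1 (fun y => step theta (score k n v y))) <= 1952 / INR k.
Proof.
  intros Hk HD0 HD1 HM Hd Hreg.
  assert (K : 2 <= INR k) by (apply (le_INR 2); auto).
  set (t := fun i j => if hd i j then 0 else v i j).
  set (T2 := sumR (seq 0 n) (fun j => sumR (seq 0 k) (fun i => if hd i j then 0 else v i j ^ 2))).
  assert (Sq : forall i j, 0 <= (if hd i j then 0 else v i j ^ 2))
    by (intros; destruct (hd _ _); [lra|apply pow2_ge_0]).
  assert (T2_pos : 0 <= T2) by (apply sumR_nonneg; intros; apply sumR_nonneg; auto).
  assert (Row : forall i, (i < k)%nat -> sumR (seq 0 n) (fun j => if hd i j then 0 else v i j ^ 2) <= T2).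
  { intros i Hi. unfold T2. rewrite sumR_swap.
    apply (sumR_term_le (seq 0 k) (fun i => sumR (seq 0 n) (fun j => if hd i j then 0 else v i j ^ 2)));
      [intros; apply sumR_nonneg; auto|apply in_seq; lia]. }
  assert (Ht : forall i j, (i < k)%nat -> (j < n)%nat -> t i j ^ 2 <= tau k ^ 2 * T2).
  { intros i j Hi Hj. unfold t. assert (P := pow2_ge_0 (tau k)). destruct (hd i j) eqn:E.
    - assert (0 <= tau k ^ 2 * T2) by (apply Rmult_le_pos; auto). lra.
    - eapply Rle_trans; [apply Hreg; auto|]. apply Rmult_le_compat_l; auto. }
  destruct (Rle_lt_or_eq_dec _ _ T2_pos) as [HT|HT].
  - set (T := sqrt T2).
    assert (ET : T ^ 2 = T2) by (unfold T; simpl; rewrite Rmult_1_r; now apply sqrt_sqrt).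
    assert (PT : 0 < T) by now apply sqrt_lt_R0.
    (* Half of [T / k^2], because the window of [smoothing_error] has radius [2 * lam]. *)
    set (lam := T / INR k ^ 2 / 2).
    assert (Pl : 0 < lam).
    { unfold lam. assert (0 < T / INR k ^ 2) by (apply Rdiv_lt_0_compat; nra). lra. }
    set (G := fun s => smooth_step ((s - theta) / lam)).
    assert (Smooth : forall D, is_distr k D ->
      Rabs (testE k n D (fun y => step theta (score k n v y))
            - testE k n D (fun y => G (score k n v y))) <= 960 / INR k).
    { intros D HD.
      eapply Rle_trans; [apply (testE_diff_le k n D _ _
        (fun y => 30 * near (theta + 2 * lam) (2 * lam) (score k n v y))); auto|].
      - intros y. now apply smoothing_error.
      - rewrite testE_scal. replace (960 / INR k) with (30 * (32 / INR k)) by (field; lra).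
        apply Rmult_le_compat_l; [lra|].
        replace (2 * lam) with (T / INR k ^ 2) by (unfold lam; field; lra).
        apply regular_concentration with hd; auto.
        (* Regularity gives [Rabs (v i j) <= tau k * T], and [tau k = k^-7 <= k^-2]. *)
        intros i j Hi Hj E. assert (A := Ht i j Hi Hj). unfold t in A. rewrite E in A.
        replace (T / INR k ^ 2) with (/ INR k ^ 2 * Rabs T)
          by (rewrite (Rabs_right T) by lra; field; lra).
        assert (0 < / INR k ^ 2) by (apply Rinv_0_lt_compat; nra).
        apply Rabs_le_of_sqr; [lra|]. rewrite ET. eapply Rle_trans; [exact A|].
        apply Rmult_le_compat_r; auto. apply pow_incr. unfold tau. split.
        + left. apply Rinv_0_lt_compat, pow_lt. lra.
        + apply Rinv_le_contravar; [nra|]. apply Rle_pow; [lra|lia]. }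
    set (e := fun j => (sumR (seq 0 k) (fun i => Rabs (t i j)) / lam) ^ 4).
    assert (Exch : Rabs (testE k n D0 (fun y => G (score k n v y))
                         - testE k n D1 (fun y => G (score k n v y))) <= 2 * sumR (seq 0 n) e).
    { apply column_lindeberg with hd
        (fun b => fourth_diff (fun y => 4 * Rmax 0 y ^ 3) ((b - theta) / lam) / lam)
        (fun b => fourth_diff (fun y => 6 * Rmax 0 y ^ 2) ((b - theta) / lam) / lam ^ 2)
        (fun b => fourth_diff (fun y => 4 * Rmax 0 y) ((b - theta) / lam) / lam ^ 3); auto.
      intros j Hj b c x.
      apply Rle_trans with ((x / lam) ^ 4).
      - assert (A := smooth_step_taylor ((b - theta) / lam) (x / lam)). unfold G.
        replace ((b + x - theta) / lam) with ((b - theta) / lam + x / lam) by (field; lra).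
        eapply Rle_trans; [|exact A]. right. f_equal. field. lra.
      - unfold e, Rdiv. rewrite !Rpow_mult_distr. apply Rmult_le_compat_r.
        + apply pow_le. left. now apply Rinv_0_lt_compat.
        + replace (x ^ 4) with (Rabs x ^ 4).
          * apply pow_incr. split; [apply Rabs_pos|]. apply Rabs_colsum_le.
          * replace (Rabs x ^ 4) with ((Rabs x ^ 2) ^ 2) by ring. rewrite pow2_abs. ring. }
    (* One factor [A^2] is bounded by the mass [B] of the column, the other by regularity. Summing
       [B] to [T^2] gives [k^3 tau^2 T^4 / lam^4 = 16 / k^3]. *)
    assert (Err : sumR (seq 0 n) e <= 16 / INR k).
    { set (k1 := INR k) in *.
      apply Rle_trans with (sumR (seq 0 n) (fun j =>
        k1 ^ 3 * tau k ^ 2 * T2 / lam ^ 4 * sumR (seq 0 k) (fun i => if hd i j then 0 else v i j ^ 2))).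
      - apply sumR_le. intros j Hj. apply in_seq in Hj. unfold e.
        set (A := sumR (seq 0 k) (fun i => Rabs (t i j))).
        set (B := sumR (seq 0 k) (fun i => if hd i j then 0 else v i j ^ 2)).
        assert (HA : A ^ 2 <= k1 * B).
        { unfold A. eapply Rle_trans; [apply sumR_sqr_le|]. rewrite length_seq. fold k1.
          apply Rmult_le_compat_l; [lra|]. right. apply sumR_ext. intros i _.
          rewrite pow2_abs. unfold t. destruct (hd i j); ring. }
        assert (HB : B <= k1 * (tau k ^ 2 * T2)).
        { apply Rle_trans with (sumR (seq 0 k) (fun _ => tau k ^ 2 * T2)).
          - apply sumR_le. intros i Hi. apply in_seq in Hi.
            assert (X := Ht i j ltac:(lia) ltac:(lia)). unfold t in X.
            destruct (hd i j); [|exact X]. simpl in X. lra.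
          - rewrite sumR_const, length_seq. fold k1. lra. }
        assert (PB : 0 <= B) by (apply sumR_nonneg; auto).
        replace ((A / lam) ^ 4) with (A ^ 2 * A ^ 2 / lam ^ 4) by (field; lra).
        replace (k1 ^ 3 * tau k ^ 2 * T2 / lam ^ 4 * B)
          with ((k1 * B) * (k1 * (k1 * (tau k ^ 2 * T2))) / lam ^ 4) by (field; lra).
        apply Rmult_le_compat_r; [left; apply Rinv_0_lt_compat, pow_lt; auto|].
        apply Rmult_le_compat; try apply pow2_ge_0; auto.
        eapply Rle_trans; [exact HA|]. apply Rmult_le_compat_l; lra.
      - rewrite sumR_scal. fold T2. unfold lam, tau. fold k1. rewrite <- ET.
        replace (k1 ^ 3 * (/ k1 ^ 7) ^ 2 * T ^ 2 / (T / k1 ^ 2 / 2) ^ 4 * T ^ 2)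
          with (16 / k1 ^ 3) by (field; lra).
        apply Rmult_le_compat_l; [lra|]. apply Rinv_le_contravar; [lra|].
        rewrite <- (pow_1 k1) at 1. apply Rle_pow; [lra|lia]. }
    assert (S0 := Smooth D0 HD0). assert (S1 := Smooth D1 HD1).
    apply Rabs_le_between in S0, S1, Exch. apply Rabs_le_between.
    unfold Rdiv in *. lra.
  (* With zero total tail mass every tail sum is 0 and the Taylor remainder vanishes, so the
     discontinuous [step] is exchanged directly. *)
  - apply Rle_trans with (2 * sumR (seq 0 n) (fun _ => 0)).
    + apply column_lindeberg with hd (fun _ => 0) (fun _ => 0) (fun _ => 0); auto.
      intros j Hj b c x.
      assert (X : x = 0).
      { apply sumR_zero. intros i Hi. apply in_seq in Hi.
        assert (A := Ht i j ltac:(lia) Hj). rewrite <- HT, Rmult_0_r in A.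
        fold (t i j). assert (Z : t i j = 0) by (apply Rsqr_0_uniq; unfold Rsqr; nra).
        rewrite Z. ring. }
      rewrite X, Rplus_0_r. replace (_ - _) with 0 by ring. rewrite Rabs_R0. lra.
    + rewrite sumR_zero by auto. rewrite Rmult_0_r. apply Rdiv_le_0_compat; lra.
Qed.

Lemma accept_prob_testE k n D0 D1 w theta : (2 <= k)%nat -> is_distr k D0 ->
  accept_prob k n D0 D1 (halfspace k n w theta)
  = 1 / 2 + (testE k n D1 (fun y => step theta (score k n w y))
             - testE k n D0 (fun y => step theta (score k n w y))) / 2.
Proof.
  intros Hk HD. unfold accept_prob.
  assert (E0 : sumR (lists_of (bvecs k) n) 
      (fun y => test_prob k n D0 y * (if halfspace k n w theta y then 0 else 1))
    = 1 - testE k n D0 (fun y => step theta (score k n w y))).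
  { transitivity (sumR (lists_of (bvecs k) n) (test_prob k n D0)
      - testE k n D0 (fun y => step theta (score k n w y)));
      [|now rewrite test_prob_sum].
    unfold testE. rewrite <- sumR_minus. apply sumR_ext. intros y _. rewrite <- halfspace_step. destruct (halfspace _ _ _ _ _); ring. }
  assert (E1 : sumR (lists_of (bvecs k) n) 
      (fun y => test_prob k n D1 y * (if halfspace k n w theta y then 1 else 0))
    = testE k n D1 (fun y => step theta (score k n w y))).
  { apply sumR_ext. intros y _. now rewrite <- halfspace_step. }
  rewrite E0, E1. lra.
Qed.

Theorem theorem4p6 :
  exists C : R,
  forall (k Rn : nat) (D0 D1 : list bool -> R),
    (2 <= k)%nat -> (1 <= Rn)%nat ->
    is_distr k D0 -> is_distr k D1 ->
    pr_allzero k D0 >= 1 - 2 / sqrt (INR k) ->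
    pr_allzero k D1 <= 1 / sqrt (INR k) ->
    moments_match4 k D0 D1 ->
    forall (w : nat -> nat -> R) (theta : R),
      (forall i j : nat, (i < k)%nat -> (j < k)%nat -> i <> j ->
         forall l : nat, ~ (inB (t_param k Rn) Rn (w i) l /\ inB (t_param k Rn) Rn (w j) l)) ->
      accept_prob k Rn D0 D1 (halfspace k Rn w theta) <= 1/2 + C / INR k.
Proof.
  (* Half of [1952 + 1 + 1]: the regular comparison and one truncation for each distribution. *)
  exists 977. intros k n D0 D1 Hk Hn HD0 HD1 _ _ HM w theta Hdisj.
  assert (K : 2 <= INR k) by (apply (le_INR 2); auto).
  destruct (finite_choice (fun i (hv : (nat -> bool) * (nat -> R)) =>
    (forall j, (j < n)%nat -> fst hv j = true -> inB (t_param k n) n (w i) j) /\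
    (forall j, (j < n)%nat -> fst hv j = false ->
       snd hv j ^ 2 <= tau k ^ 2 * sumR (seq 0 n) (fun i => if fst hv i then 0 else snd hv i ^ 2)) /\
    ((forall j, (j < n)%nat -> snd hv j = w i j) \/
     exists l, NoDup l /\ (forall j, In j l -> (j < n)%nat) /\
       4 * INR k ^ 2 * ln (INR k) <= INR (length l) /\
       separated (2 * INR k * sumR (seq 0 n) (fun j => Rabs (w i j - snd hv j))) (map (snd hv) l)))
    (fun _ => true, fun _ => 0) k) as [f Hf].
  { intros i _. destruct (row_structure k n (w i) Hk Hn) as [hd [v H]]. now exists (hd, v). }
  set (hd := fun i => fst (f i)). set (v := fun i => snd (f i)).
  assert (Trunc : forall D, is_distr k D -> Rabs (testE k n D (fun y => step theta (score k n w y))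
        - testE k n D (fun y => step theta (score k n v y))) <= 1 / INR k).
  { intros D HD. apply truncation_error; auto. intros i Hi. apply (Hf i Hi). }
  assert (Reg : Rabs (testE k n D0 (fun y => step theta (score k n v y))
        - testE k n D1 (fun y => step theta (score k n v y))) <= 1952 / INR k).
  { apply regular_soundness with hd; auto.
    (* A column that is in the heads of two rows would lie in both sets [inB], which are
       disjoint. *)
    - intros i i' j Hi Hi' Hj H H'. destruct (Nat.eq_dec i i') as [|N]; auto. exfalso.
      apply (Hdisj i i' Hi Hi' N j). split; [apply (Hf i Hi)|apply (Hf i' Hi')]; auto.
    - intros i j Hi Hj. now apply (Hf i Hi). }
  assert (T0 := Trunc D0 HD0). assert (T1 := Trunc D1 HD1).
  apply Rabs_le_between in T0, T1, Reg.
  rewrite accept_prob_testE by auto. unfold Rdiv in *. lra.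
Qed.
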